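(* Let $\mathcal{G}=\langle T,D\rangle\subset GL(2,\mathbf{C})$, the representations $\rho_3,\rho_5,\rho_{10},\rho_{13},\rho_{15}$ of $\mathcal{G}$, the $\mathbf{C}[x,y]^{\mathcal{G}}$-modules $M(\rho)$ of vector-valued invariants, and the dimension formula $H_{M(\rho)}(t)$ be as defined in the context. Then the following hold. 1. $M(\rho_3)$ is a free $\mathbf{C}[x,y]^{\mathcal{G}}$-module generated by $$-x^5y+xy^5,$$ and its dimension formula is $$H_{M(\rho_3)}(t)=\frac{t^6}{(1-t^8)(1-t^{12})}=t^6+t^{14}+t^{18}+t^{22}+t^{26}+\cdots.$$ 2. $M(\rho_5)$ is a free $\mathbf{C}[x,y]^{\mathcal{G}}$-module generated by $$\begin{pmatrix} x^4+y^4\\ 6x^2y^2\end{pmatrix},\quad \begin{pmatrix} -x^8+10x^4y^4-y^8\\ 12x^6y^2+12x^2y^6\end{pmatrix},$$ and its dimension formula is $$H_{M(\rho_5)}(t)=\frac{t^4+t^8}{(1-t^8)(1-t^{12})}=t^4+t^8+t^{12}+2t^{16}+2t^{20}+\cdots.$$ 3. $M(\rho_{10})$ is a free $\mathbf{C}[x,y]^{\mathcal{G}}$-module generated by $$\begin{pmatrix} x\\ y\end{pmatrix},\quad \begin{pmatrix} -x^5+5xy^4\\ 5x^4y-y^5\end{pmatrix},$$ and its dimension formula is $$H_{M(\rho_{10})}(t)=\frac{t+t^5}{(1-t^8)(1-t^{12})}=t+t^5+t^9+2t^{13}+2t^{17}+2t^{21}+\cdots.$$ 4. $M(\rho_{13})$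 is a free $\mathbf{C}[x,y]^{\mathcal{G}}$-module generated by $$\begin{pmatrix} x^2\\ xy\\ y^2\end{pmatrix},\quad \begin{pmatrix} -x^6+5x^2y^4\\ 2x^5y+2xy^5\\ 5x^4y^2-y^6\end{pmatrix},\quad \begin{pmatrix} -x^2(x^4-5y^4)^2\\ xy(5x^4-y^4)(x^4-5y^4)\\ -y^2(5x^4-y^4)^2\end{pmatrix},$$ and its dimension formula is $$H_{M(\rho_{13})}(t)=\frac{t^2+t^6+t^{10}}{(1-t^8)(1-t^{12})}=t^2+t^6+2t^{10}+2t^{14}+3t^{18}+3t^{22}+\cdots.$$ 5. $M(\rho_{15})$ is a free $\mathbf{C}[x,y]^{\mathcal{G}}$-module generated by $$\begin{pmatrix} x^3\\ x^2y\\ xy^2\\ y^3\end{pmatrix},\quad \begin{pmatrix} -x^7+5x^3y^4\\ x^6y+3x^2y^5\\ 3x^5y^2+xy^6\\ 5x^4y^3-y^7\end{pmatrix},\quad \begin{pmatrix} -6x^7y^4+6x^3y^8\\ -x^{10}y+x^2y^9\\ x^9y^2-xy^{10}\\ 6x^8y^3-6x^4y^7\end{pmatrix},\quad \begin{pmatrix} -24x^{11}y^4+24x^7y^8\\ x^{14}y-7x^{10}y^5+3x^6y^9+3x^2y^{13}\\ 3x^{13}y^2+3x^9y^6-7x^5y^{10}+xy^{14}\\ 24x^8y^7-24x^4y^{11}\end{pmatrix},$$ and its dimension formula is $$H_{M(\rho_{15})}(t)=\frac{t^3+t^7+t^{11}+t^{15}}{(1-t^8)(1-t^{12})}=t^3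+t^7+2t^{11}+3t^{15}+3t^{19}+4t^{23}+\cdots.$$
   Context: Let $i=\sqrt{-1}$ and let $\mathcal{G}=\langle T,D\rangle\subset GL(2,\mathbf{C})$ with $$T=\frac{1+i}{2}\begin{pmatrix}1&1\\1&-1\end{pmatrix},\qquad D=\begin{pmatrix}1&0\\0&i\end{pmatrix}.$$ This is a finite group of order 96 (No. 8 in the Shephard–Todd classification). Write $\bm{x}=\begin{pmatrix} x \\ y \end{pmatrix}$; $\mathcal{G}$ acts on $\mathbf{C}[x,y]$ by $(g.f)(\bm{x})=f(g\bm{x})$, where $g\bm{x}$ is the matrix product, and $\mathbf{C}[x,y]^{\mathcal{G}}$ is the ring of polynomials $f$ with $f(g\bm{x})=f(\bm{x})$ for all $g\in\mathcal{G}$. For a representation $\rho:\mathcal{G}\to GL(m,\mathbf{C})$, the module of vector-valued invariants is $$M(\rho)=\{F\in\mathbf{C}[x,y]^m : F(g\bm{x})=\rho(g)F(\bm{x})\ \text{for all } g\in\mathcal{G}\},$$ where elements of $\mathbf{C}[x,y]^m$ are column vectors and $\rho(g)F(\bm{x})$ is the matrix product. It is a $\mathbf{C}[x,y]^{\mathcal{G}}$-module, graded by degree: $M(\rho)_k$ is the finite-dimensional complex vector space of those elements of $M(\rho)$ all of whose components are homogeneous of degree $k$ (or zero). The dimension formula of $M(\rho)$ is $H_{M(\rho)}(t)=\sum_{k\ge 0}\dim_{\mathbf{C}}M(\rho)_k\,t^k$. The representations of $\mathcal{G}$ are determined by their values on $T$ and $D$: - $\rho_3$ (degree 1): $\rho_3=\det$,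 i.e. $\rho_3(T)=-i$, $\rho_3(D)=i$. - $\rho_5$ (degree 2): $\rho_5(T)=\frac{-1}{2}\begin{pmatrix}1&1\\3&-1\end{pmatrix}$, $\rho_5(D)=\mathrm{diag}(1,-1)$. - $\rho_{10}$ (degree 2): $\rho_{10}(T)=T$, $\rho_{10}(D)=D$. - $\rho_{13}$ (degree 3): $\rho_{13}(T)=\frac{i}{2}\begin{pmatrix}1&2&1\\1&0&-1\\1&-2&1\end{pmatrix}$, $\rho_{13}(D)=\mathrm{diag}(1,i,-1)$. - $\rho_{15}$ (degree 4): $\rho_{15}(T)=\frac{-1+i}{4}\begin{pmatrix}1&3&3&1\\1&1&-1&-1\\1&-1&-1&1\\1&-3&3&-1\end{pmatrix}$, $\rho_{15}(D)=\mathrm{diag}(1,i,-1,-i)$. *)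

(* Defs.v *)
From HB Require Import structures.
From mathcomp Require Import all_boot all_order all_algebra.
From mathcomp Require Import reals.
From mathcomp Require Import complex mpoly.

Set Implicit Arguments.
Unset Strict Implicit.
Unset Printing Implicit Defensive.

Import Order.TTheory GRing.Theory Num.Theory.
Local Open Scope ring_scope.

Definition colv (A : Type) (m : nat) (t : m.-tuple A) : 'cV[A]_m :=
  \col_i tnth t i.

Definition mxrows (A : Type) (m n : nat) (t : m.-tuple (n.-tuple A)) :
  'M[A]_(m, n) := \matrix_(i, j) tnth (tnth t i) j.

Definition diagm (A : nmodType) (m : nat) (t : m.-tuple A) : 'M[A]_m :=
  diag_mx (\row_j tnth t j).

Section VectorValuedInvariants.
Variable R : realType.
Local Notation C := R[i].
Local Notation Cxy := {mpoly C[2]}.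

Definition matT : 'M[C]_2 :=
  ((1 + 'i%C) / 2%:R) *: mxrows [tuple [tuple 1; 1]; [tuple 1; -1]].

Definition matD : 'M[C]_2 := diagm [tuple 1; 'i%C].

Inductive groupG : 'M[C]_2 -> Prop :=
| groupG_T : groupG matT
| groupG_D : groupG matD
| groupG_1 : groupG 1%:M
| groupG_M g h : groupG g -> groupG h -> groupG (g *m h)
| groupG_V g : groupG g -> groupG (invmx g).

(* Only the values on G matter: rho is an arbitrary function elsewhere. *)
Definition is_representation (m : nat) (rho : 'M[C]_2 -> 'M[C]_m) : Prop :=
  (forall g, groupG g -> rho g \in unitmx) /\
  (forall g h, groupG g -> groupG h -> rho (g *m h) = rho g *m rho h).

Definition representation_with_values (m : nat) (A B : 'M[C]_m)
    (rho : 'M[C]_2 -> 'M[C]_m) : Prop :=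
  [/\ is_representation rho, rho matT = A & rho matD = B].

Definition rho3T : 'M[C]_1 := mxrows [tuple [tuple - 'i%C]].
Definition rho3D : 'M[C]_1 := mxrows [tuple [tuple 'i%C]].

Definition rho5T : 'M[C]_2 :=
  (-1 / 2%:R) *: mxrows [tuple [tuple 1; 1]; [tuple 3%:R; -1]].
Definition rho5D : 'M[C]_2 := diagm [tuple 1; -1].

Definition rho10T : 'M[C]_2 := matT.
Definition rho10D : 'M[C]_2 := matD.

Definition rho13T : 'M[C]_3 :=
  ('i%C / 2%:R) *: mxrows [tuple [tuple 1; 2%:R; 1];
                                 [tuple 1; 0; -1];
                                 [tuple 1; - 2%:R; 1]].
Definition rho13D : 'M[C]_3 := diagm [tuple 1; 'i%C; -1].

Definition rho15T : 'M[C]_4 :=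
  ((-1 + 'i%C) / 4%:R) *: mxrows [tuple [tuple 1; 3%:R; 3%:R; 1];
                                        [tuple 1; 1; -1; -1];
                                        [tuple 1; -1; -1; 1];
                                        [tuple 1; - 3%:R; 3%:R; -1]].
Definition rho15D : 'M[C]_4 := diagm [tuple 1; 'i%C; -1; - 'i%C].

(* f(g x): the variable 'X_i is replaced by the i-th entry of g *m (x, y)^T. *)
Definition subst_lin (g : 'M[C]_2) (f : Cxy) : Cxy :=
  f \mPo [tuple \sum_j g i j *: 'X_j | i < 2].

Definition invariant (f : Cxy) : Prop :=
  forall g, groupG g -> subst_lin g f = f.

(* Membership in M(rho): F(g x) = rho(g) F(x) for all g in G. *)
Definition vvinv (m : nat) (rho : 'M[C]_2 -> 'M[C]_m) (F : 'cV[Cxy]_m) : Prop :=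
  forall g, groupG g ->
    map_mx (subst_lin g) F = map_mx (fun c => c%:MP_[2]) (rho g) *m F.

Definition free_basis (m : nat) (rho : 'M[C]_2 -> 'M[C]_m)
    (k : nat) (b : k.-tuple 'cV[Cxy]_m) : Prop :=
  [/\ forall j, vvinv rho (tnth b j),
      forall F, vvinv rho F ->
        exists2 c : 'I_k -> Cxy, forall j, invariant (c j)
          & F = \sum_j c j *: tnth b j
    & forall c : 'I_k -> Cxy, (forall j, invariant (c j)) ->
        \sum_j c j *: tnth b j = 0 -> forall j, c j = 0].

(* [dhomog 2 C k] is the finite-dimensional space of the polynomials that are *)
(* 0 or homogeneous of degree k, so U below is M(rho)_k.                      *)
Definition graded_dim (m : nat) (rho : 'M[C]_2 -> 'M[C]_m) (k d : nat) : Prop :=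
  exists2 U : {vspace {ffun 'I_m -> dhomog 2 C k}},
    forall F : {ffun 'I_m -> dhomog 2 C k},
      F \in U <-> vvinv rho (\col_i (F i : Cxy))
    & \dim U = d.

(* The power series H = \sum_k (dim M(rho)_k) t^k equals num / den in         *)
(* Z[[t]], i.e. den * H = num (used with den`_0 = 1, so that den is           *)
(* invertible), and H agrees with the polynomial e up to the degree of e.     *)
Definition dimension_formula (m : nat) (rho : 'M[C]_2 -> 'M[C]_m)
    (num den e : {poly int}) : Prop :=
  exists H : nat -> nat,
    [/\ forall k, graded_dim rho k (H k),
        forall n, \sum_(j < n.+1) den`_j * (H (n - j)%N)%:Z = num`_n
      & forall k, (k < size e)%N -> (H k)%:Z = e`_k].

End VectorValuedInvariants.

(* Main.v *)
Require Import Defs.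
From HB Require Import structures.
From mathcomp Require Import all_boot all_order all_algebra.
From mathcomp Require Import boolp reals.
From mathcomp Require Import complex mpoly.
From mathcomp Require Import ring zify.

Set Implicit Arguments.
Unset Strict Implicit.
Unset Printing Implicit Defensive.

Import Order.TTheory GRing.Theory Num.Theory.
Local Open Scope ring_scope.

(** Why the theorem holds.  The element D of the group is a reflection
of order 4 with mirror y = 0, and the images of this mirror under the group are
the six zero lines of the octahedral vertex form J = x y^5 - x^5 y.

A polynomial f with f(x, iy) = i^e f(x, y) and e < 4 is divisible by y^e
([divides_y_exp]).  Let rho be a representation with rho(D) = diag(i^(e_r)),
and M a square matrix of polynomials with M(gx) = rho(g) M(x).  Row r of M is
divisible by y^(e_r), so det M is divisible by y^E with E the sum of the e_r.
Since det M is multiplied by a constant under each g, it is divisible by the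
E-th power of each of the six mirror forms, which are pairwise non-associated
primes; hence J^E divides det M ([vvinv_det_dvd]).

Now let B be the square matrix whose columns are the proposed generators.  In
each of the five cases det B is a nonzero constant times exactly J^E.  Given F
in M(rho), Cramer's rule writes (det B) F as the combination of the columns of
B with coefficients the determinants of B with one column replaced by F.  These
are divisible by J^E too, and the quotients are invariant because numerator
and denominator have the same multiplier det rho(g).  So the columns of B are
a free basis ([free_basis_criterion]).  The matrix B also yields the
representation itself: rho(g) is the unique constant matrix A with
B(gx) = A B(x) ([exists_representation]).

By freeness the dimension formulas reduce to the ring of invariants.  On the
axis y = 0 an invariant of degree n restricts to c x^n, where c = 0 unless n is
a multiple of 4 other than 4; for these n some product of the face form (degree
8) and the edge form (degree 12) restricts to x^n.  An invariant vanishing on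
the axis is divisible by J^4, of degree 24, with invariant quotient.  Hence
dim(n) = dim(n - 24) + [4 | n and n <> 4], an explicit basis
([inv_span], [inv_free]), and the series 1 / ((1 - t^8)(1 - t^12))
([molien_conv]).

What is left for each module are polynomial identities: the action of T and D
on the generators, the degrees, and the determinant.  They are established over
an arbitrary commutative ring, the scalar of T entering as an element k with
4 k^4 = -1. *)

(** * Octahedral forms *)

(** The degrees 8a + 12b. *)
Definition lead_degree n := (4 %| n)%N && (n != 4)%N.

Lemma lead_degreeP n : lead_degree n -> ~~ (8 %| n)%N -> n = (12 + 8 * ((n - 12) %/ 8))%N.
Proof. by rewrite /lead_degree; lia. Qed.

Section OctahedralForms.
Variable A : comNzRingType.
Implicit Types x y k : A.

Definition vertex_form x y := - x ^+ 5 * y + x * y ^+ 5.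
Definition face_form x y := x ^+ 8 + 14%:R * x ^+ 4 * y ^+ 4 + y ^+ 8.
Definition edge_form x y :=
  x ^+ 12 - 33%:R * x ^+ 8 * y ^+ 4 - 33%:R * x ^+ 4 * y ^+ 8 + y ^+ 12.

(** In the identities for T the scalar k of T = k [[1, 1], [1, -1]] is only known
through 4 k^4 = -1; each side is first matched up to a power of that quantity,
which is a plain ring identity. *)
Lemma vertex_form_T k x y : k ^+ 4 * 4%:R = -1 ->
  vertex_form (k * (x + y)) (k * (x - y)) = - (k * k *+ 2) * vertex_form x y.
Proof.
move=> k4; transitivity ((k ^+ 4 * 4%:R) * (k * k *+ 2) * vertex_form x y).
  by rewrite /vertex_form; clear; ring.
by rewrite k4 mulN1r.
Qed.

Lemma face_form_T k x y : k ^+ 4 * 4%:R = -1 ->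
  face_form (k * (x + y)) (k * (x - y)) = face_form x y.
Proof.
move=> k4; transitivity ((k ^+ 4 * 4%:R) ^+ 2 * face_form x y).
  by rewrite /face_form; clear; ring.
by rewrite k4 sqrrN expr1n mul1r.
Qed.

Lemma edge_form_T k x y : k ^+ 4 * 4%:R = -1 ->
  edge_form (k * (x + y)) (k * (x - y)) = edge_form x y.
Proof.
move=> k4; transitivity (- (k ^+ 4 * 4%:R) ^+ 3 * edge_form x y).
  by rewrite /edge_form; clear; ring.
by rewrite k4 exprS sqrrN expr1n mulr1 opprK mul1r.
Qed.

Lemma vertex_form_D k x y : k ^+ 4 = 1 -> vertex_form x (k * y) = k * vertex_form x y.
Proof.
by move=> k4; rewrite /vertex_form exprMn (exprS k) k4; ring.
Qed.

Lemma face_form_D k x y : k ^+ 4 = 1 -> face_form x (k * y) = face_form x y.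
Proof.
by move=> k4; rewrite /face_form !exprMn (exprM k 4 2) k4 expr1n !mul1r.
Qed.

Lemma edge_form_D k x y : k ^+ 4 = 1 -> edge_form x (k * y) = edge_form x y.
Proof.
by move=> k4; rewrite /edge_form !exprMn (exprM k 4 2) (exprM k 4 3) k4 !expr1n !mul1r.
Qed.

Lemma face_form_axis x : face_form x 0 = x ^+ 8.
Proof. by rewrite /face_form !expr0n !mulr0 !addr0. Qed.

Lemma edge_form_axis x : edge_form x 0 = x ^+ 12.
Proof. by rewrite /edge_form !expr0n !mulr0 !subr0 addr0. Qed.

(** A product of the two invariant forms of the given degree with leading term x^n. *)
Definition lead_form n x y :=
  if (8 %| n)%N then face_form x y ^+ (n %/ 8)
  else face_form x y ^+ ((n - 12) %/ 8) * edge_form x y.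

Lemma lead_form_axis n x : lead_degree n -> lead_form n x 0 = x ^+ n.
Proof.
move=> nP; rewrite /lead_form face_form_axis edge_form_axis; case: ifPn => n8.
  by rewrite -exprM mulnC divnK.
by rewrite -exprM -exprD [in RHS](lead_degreeP nP n8) addnC.
Qed.

End OctahedralForms.

Section OctahedralMorph.
Variables (A B : comNzRingType) (f : {rmorphism A -> B}).

Lemma rmorph_vertex_form x y : f (vertex_form x y) = vertex_form (f x) (f y).
Proof. by rewrite rmorphD !(rmorphXn, rmorphN, rmorphM). Qed.

Lemma rmorph_face_form x y : f (face_form x y) = face_form (f x) (f y).
Proof. by rewrite !rmorphD !(rmorphXn, rmorphM, rmorph_nat). Qed.

Lemma rmorph_edge_form x y : f (edge_form x y) = edge_form (f x) (f y).
Proof. by rewrite rmorphD !rmorphB !(rmorphXn, rmorphM, rmorph_nat). Qed.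

Lemma rmorph_lead_form n x y : f (lead_form n x y) = lead_form n (f x) (f y).
Proof.
rewrite /lead_form; case: ifP => _.
  by rewrite rmorphXn rmorph_face_form.
by rewrite rmorphM rmorphXn rmorph_face_form rmorph_edge_form.
Qed.

End OctahedralMorph.

(** * Divisibility and linear algebra over a domain *)

Section Divides.
Variable A : comNzRingType.
Implicit Types p q u v w : A.

Definition divides p q := exists r, q = r * p.

Lemma divides_expN k p q : divides ((- p) ^+ k) q -> divides (p ^+ k) q.
Proof. by case=> r ->; exists (r * (-1) ^+ k); rewrite (exprNn p) mulrA. Qed.

(** Divisibility transported by a linear substitution holds only up to constants. *)
Lemma divides_units k p q u w w' : w' * w = 1 ->
  divides ((u * p) ^+ k) (w * q) -> divides (p ^+ k) q.
Proof.
move=> w'w [r Er]; exists (w' * r * u ^+ k).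
by rewrite -[q]mul1r -w'w -mulrA Er exprMn !mulrA.
Qed.

End Divides.

Lemma map_mx_comp_acts (A : comNzRingType) m n (s t : {rmorphism A -> A})
    (M N : 'M[A]_m) (F : 'M[A]_(m, n)) :
  map_mx s F = M *m F -> map_mx t F = N *m F -> map_mx t M = M ->
  map_mx t (map_mx s F) = M *m N *m F.
Proof. by move=> Fs Ft Mt; rewrite Fs map_mxM Mt Ft mulmxA. Qed.

Lemma mulmx_det_neq0_inj (A : idomainType) m n (B : 'M[A]_n) : \det B != 0 ->
  injective (mulmx^~ B : 'M_(m, n) -> 'M_(m, n)).
Proof.
move=> B0 M N /(congr1 (mulmx^~ (\adj B))) /=; rewrite -!mulmxA mul_mx_adj.
rewrite !mul_mx_scalar => /matrixP E; apply/matrixP=> i j.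
by have := E i j; rewrite !mxE => /(mulfI B0).
Qed.

Definition replace_col (A : Type) m (B : 'M[A]_m) (F : 'cV[A]_m) (j : 'I_m) : 'M[A]_m :=
  \matrix_(r, s) if s == j then F r ord0 else B r s.

Lemma replace_col_acts (A : comNzRingType) m (s : {rmorphism A -> A}) (M B : 'M[A]_m) F j :
  map_mx s B = M *m B -> map_mx s F = M *m F ->
  map_mx s (replace_col B F j) = M *m replace_col B F j.
Proof.
move=> /matrixP EB /matrixP EF; apply/matrixP=> r k.
have := EB r k; have := EF r ord0; rewrite !mxE => EFr EBr.
by case: ifP => kj; rewrite ?EFr ?EBr; apply: eq_bigr => l _; rewrite !mxE kj.
Qed.

Lemma cramer (A : comNzRingType) m (B : 'M[A]_m) (F : 'cV[A]_m) :
  \det B *: F = B *m \col_j \det (replace_col B F j).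
Proof.
rewrite -mul_scalar_mx -mul_mx_adj -mulmxA; congr (_ *m _).
apply/matrixP=> j k; rewrite (ord1 k) [RHS]mxE (expand_det_col _ j) mxE.
apply: eq_bigr => r _; rewrite !mxE eqxx mulrC; congr (_ * _).
rewrite /cofactor; congr (_ * \det _).
by apply/matrixP=> u v; rewrite !mxE eq_sym (negPf (neq_lift _ _)).
Qed.

Lemma cramer_quotient (A : idomainType) m (B : 'M[A]_m) (F : 'cV[A]_m) (a : 'I_m -> A) :
  \det B != 0 -> (forall j, \det (replace_col B F j) = \det B * a j) ->
  F = B *m \col_j a j.
Proof.
move=> B0 Ea; have := cramer B F.
have -> : \col_j \det (replace_col B F j) = \det B *: \col_j a j.
  by apply/matrixP=> i k; rewrite !mxE Ea.
rewrite -scalemxAr => /matrixP E; apply/matrixP=> i k.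
by have := E i k; rewrite !mxE => /(mulfI B0).
Qed.

(** Numerator and denominator have the same multiplier u under s, so that the
quotient is fixed. *)
Lemma quotient_fixed (A : idomainType) (s : {rmorphism A -> A}) (p q a u : A) :
  p != 0 -> u != 0 -> q = p * a -> s p = u * p -> s q = u * q -> s a = a.
Proof.
move=> p0 u0 -> sp; rewrite rmorphM sp mulrA => /(mulfI _); apply.
by rewrite mulf_neq0.
Qed.

Lemma mulmx_det_neq0_injl (A : idomainType) m n (B : 'M[A]_n) : \det B != 0 ->
  injective (mulmx B : 'M_(n, m) -> 'M_(n, m)).
Proof.
move=> B0 M N /(congr1 (mulmx (\adj B))) /=; rewrite !mulmxA mul_adj_mx.
rewrite !mul_scalar_mx => /matrixP E; apply/matrixP=> i j.
by have := E i j; rewrite !mxE => /(mulfI B0).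
Qed.

(** * Linear substitutions and the group *)

Section LinearSubstitutions.
Variable R : realType.
Local Notation C := R[i].
Local Notation Cxy := {mpoly C[2]}.
Local Notation x := ('X_ord0 : Cxy).
Local Notation y := ('X_ord_max : Cxy).

HB.instance Definition _ (g : 'M[C]_2) :=
  GRing.LRMorphism.copy (@subst_lin R g)
    (comp_mpoly [tuple \sum_j g i j *: 'X_j | i < 2]).

Lemma subst_linx (g : 'M[C]_2) : subst_lin g x = g ord0 ord0 *: x + g ord0 ord_max *: y.
Proof.
rewrite /subst_lin comp_mpolyXU -tnth_nth tnth_mktuple big_ord_recl big_ord1.
by congr (_ + _ *: 'X_ _); [congr (g _ _)|]; apply/val_inj.
Qed.

Lemma subst_liny (g : 'M[C]_2) : subst_lin g y = g ord_max ord0 *: x + g ord_max ord_max *: y.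
Proof.
rewrite /subst_lin comp_mpolyXU -tnth_nth tnth_mktuple big_ord_recl big_ord1.
by congr (_ + _ *: 'X_ _); [congr (g _ _)|]; apply/val_inj.
Qed.

Lemma subst_linC (g : 'M[C]_2) (c : C) : subst_lin g c%:MP = c%:MP.
Proof. exact: comp_mpolyC. Qed.

Lemma subst_linXn (g : 'M[C]_2) (p : Cxy) k : subst_lin g (p ^+ k) = subst_lin g p ^+ k.
Proof. exact: rmorphXn. Qed.

Lemma mpoly2_ind (P : Cxy -> Prop) :
  (forall c, P c%:MP) -> P x -> P y ->
  (forall p q, P p -> P q -> P (p + q)) ->
  (forall p q, P p -> P q -> P (p * q)) -> forall p, P p.
Proof.
move=> PC Px Py PD PM; apply: mpolyind => [|c m p _ _ Pp].
  by rewrite -mpolyC0; apply: (PC).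
apply: (PD) => //; rewrite -mul_mpolyC; apply: (PM) => //.
have PX z k : P z -> P (z ^+ k).
  move=> Pz; elim: k => [|k IH]; first by rewrite expr0 -mpolyC1; apply: (PC).
  by rewrite exprS; apply: (PM).
by rewrite mpolyXE_id big_ord_recl big_ord1; apply: (PM); apply: PX.
Qed.

Lemma ord2P (i : 'I_2) : i = ord0 \/ i = ord_max.
Proof. by case: i => [[|[|//]] ?]; [left|right]; apply/val_inj. Qed.

Lemma subst_linM (g h : 'M[C]_2) (f : Cxy) : subst_lin (g *m h) f = subst_lin h (subst_lin g f).
Proof.
elim/mpoly2_ind: f => [c|||p q IHp IHq|p q IHp IHq].
- by rewrite !subst_linC.
- rewrite !subst_linx linearD /= !linearZ /= subst_linx subst_liny !mxE.
  rewrite !big_ord_recl !big_ord0 !addr0 (_ : lift _ _ = ord_max); last exact/val_inj.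
  by rewrite !scalerDr !scalerA !scalerDl addrACA.
- rewrite !subst_liny linearD /= !linearZ /= subst_linx subst_liny !mxE.
  rewrite !big_ord_recl !big_ord0 !addr0 (_ : lift _ _ = ord_max); last exact/val_inj.
  by rewrite !scalerDr !scalerA !scalerDl addrACA.
- by rewrite !rmorphD /= IHp IHq.
- by rewrite !rmorphM /= IHp IHq.
Qed.

Lemma subst_lin1 (f : Cxy) : subst_lin 1%:M f = f.
Proof.
elim/mpoly2_ind: f => [c|||p q IHp IHq|p q IHp IHq].
- by rewrite !subst_linC.
- by rewrite subst_linx !mxE /= scale1r scale0r addr0.
- by rewrite subst_liny !mxE /= scale1r scale0r add0r.
- by rewrite !rmorphD /= IHp IHq.
- by rewrite !rmorphM /= IHp IHq.
Qed.

(** The scalar of T, a primitive 8th root of unity divided by the square root of 2. *)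
Definition kappa : C := (1 + 'i%C) / 2%:R.

Lemma matTE : matT R =
  \matrix_(i, j) if (i == ord_max) && (j == ord_max) then - kappa else kappa.
Proof.
by apply/matrixP=> i j; case: (ord2P i) => ->; case: (ord2P j)=> ->;
  rewrite !mxE /= !(tnth_nth 0) /= -/kappa ?mulr1 ?mulrN1.
Qed.

Lemma mulmx1_invmx n (A B : 'M[C]_n) : A *m B = 1%:M -> A \in unitmx /\ invmx A = B.
Proof.
move=> AB; have [uA _] := mulmx1_unit AB; split=> //.
by rewrite -[invmx A]mulmx1 -AB mulKmx.
Qed.

Lemma sqr_kappa : kappa * kappa *+ 2 = 'i%C.
Proof.
have i2 : 'i%C * 'i%C = -1 :> C by rewrite -expr2 sqr_i.
have n2 : 2%:R != 0 :> C by rewrite pnatr_eq0.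
have k2 : kappa * 2%:R = 1 + 'i%C by rewrite /kappa mulfVK.
apply: (mulfI n2).
have -> : 2%:R * (kappa * kappa *+ 2) = (kappa * 2%:R) ^+ 2 by ring.
rewrite k2; have -> : (1 + 'i%C) ^+ 2 = 1 + 2%:R * 'i%C + 'i%C * 'i%C :> C by ring.
by rewrite i2; ring.
Qed.

Lemma kappa4 : kappa ^+ 4 * 4%:R = -1.
Proof.
have -> : kappa ^+ 4 * 4%:R = (kappa * kappa *+ 2) ^+ 2 by ring.
by rewrite sqr_kappa sqr_i.
Qed.

Lemma sqr_matT : matT R *m matT R = 'i%C%:M.
Proof.
rewrite matTE; apply/matrixP=> i j; rewrite !mxE big_ord_recl big_ord1 !mxE.
rewrite (_ : lift _ _ = ord_max); last exact/val_inj.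
rewrite -sqr_kappa.
by case: (ord2P i) => ->; case: (ord2P j)=> -> /=; ring.
Qed.

Lemma matD_pow k : iter k (mulmx (matD R)) 1%:M =
  diag_mx (\row_j (if j == ord_max then 'i%C ^+ k else 1)).
Proof.
elim: k => [|k IH].
  by apply/matrixP=> i j; rewrite !mxE; case: ifP; rewrite ?expr0.
rewrite iterS IH /matD /diagm; apply/matrixP=> i j.
rewrite !mul_diag_mx !mxE exprS.
case: (ord2P i) => ->; case: (ord2P j)=> -> /=; rewrite (tnth_nth 0) /=; ring.
Qed.

Lemma expi4 : 'i%C ^+ 4 = 1 :> C.
Proof. by rewrite (exprM _ 2 2) sqr_i sqrrN expr1n. Qed.

(** T and D have finite order, so inverses are products of generators: a property
closed under products needs no clause for inverses. *)
Lemma groupG_monoid_ind (P : 'M[C]_2 -> Prop) :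
  P (matT R) -> P (matD R) -> P 1%:M ->
  (forall g h, groupG g -> groupG h -> P g -> P h -> P (g *m h)) ->
  forall g, groupG g -> P g.
Proof.
move=> PT PD P1 PM g Gg.
pose Q h := groupG h /\ P h.
have QM h k : Q h -> Q k -> Q (h *m k).
  by move=> [Gh Ph] [Gk Pk]; split; [apply: groupG_M|apply: PM].
have QT : Q (matT R) by split=> //; apply: groupG_T.
have QD : Q (matD R) by split=> //; apply: groupG_D.
suff [_ [[]] ] : g \in unitmx /\ Q g /\ Q (invmx g) by [].
elim: {g} Gg => [||| g h _ [ug [Qg QVg]] _ [uh [Qh QVh]] | g _ [ug [Qg QVg]]].
- (* T^8 = 1 since T^2 = i *)
  set T := matT R in QT *.
  have : T *m (T *m ((T *m T) *m (T *m T) *m (T *m T))) = 1%:M.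
    rewrite mulmxA !sqr_matT -!scalar_mxM -expi4; congr _%:M; ring.
  by case/mulmx1_invmx=> -> ->; split=> //; split=> //; do !apply: (QM).
- (* D^4 = 1 *)
  have : matD R *m iter 3 (mulmx (matD R)) 1%:M = 1%:M.
    rewrite -iterS matD_pow; apply/matrixP=> i j; rewrite !mxE expi4.
    by case: ifP.
  case/mulmx1_invmx=> -> -> /=; split=> //; split=> //; rewrite mulmx1.
  by do !apply: (QM).
- by rewrite invmx1 unitmx1; split=> //; split; split=> //; apply: groupG_1.
- have : (g *m h) *m (invmx h *m invmx g) = 1%:M.
    by rewrite mulmxA mulmxK // mulmxV.
  by case/mulmx1_invmx=> -> ->; split=> //; split; apply: (QM).
- by rewrite unitmx_inv invmxK.
Qed.

(** * Divisibility by linear forms *)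

Definition lform (l : C * C) : Cxy := l.1 *: x + l.2 *: y.

(** The projection onto the line l = 0 along w; it is used with l(w) = 1, when its
substitution kills l and changes every polynomial by a multiple of l. *)
Definition proj_mx (l w : C * C) : 'M[C]_2 :=
  1%:M - \matrix_(i, j) ((if i == ord0 then w.1 else w.2) *
                         (if j == ord0 then l.1 else l.2)).

Lemma subst_proj_x l w : subst_lin (proj_mx l w) x = x - w.1 *: lform l.
Proof.
rewrite subst_linx !mxE /= mulr0n mulr1n /lform.
rewrite scalerDr !scalerA !scalerBl ?(scale0r, scale1r) ?sub0r.
by rewrite opprD addrA.
Qed.

Lemma subst_proj_y l w : subst_lin (proj_mx l w) y = y - w.2 *: lform l.
Proof.
rewrite subst_liny !mxE /= mulr0n mulr1n /lform.
rewrite scalerDr !scalerA !scalerBl ?(scale0r, scale1r) ?sub0r.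
by rewrite opprD addrCA.
Qed.

Lemma subst_proj_lform l w : l.1 * w.1 + l.2 * w.2 = 1 ->
  subst_lin (proj_mx l w) (lform l) = 0.
Proof.
move=> lw; rewrite [in X in subst_lin _ X]/lform linearD !linearZ /=.
rewrite subst_proj_x subst_proj_y !scalerBr addrACA -opprD !scalerA -scalerDl lw.
by rewrite scale1r subrr.
Qed.

Lemma divides_sub_proj l w f : divides (lform l) (f - subst_lin (proj_mx l w) f).
Proof.
elim/mpoly2_ind: f => [c|||p q [u IHp] [v IHq]|p q [u IHp] [v IHq]].
- by exists 0; rewrite subst_linC subrr mul0r.
- by exists w.1%:MP; rewrite subst_proj_x mul_mpolyC opprB addrCA subrr addr0.
- by exists w.2%:MP; rewrite subst_proj_y mul_mpolyC opprB addrCA subrr addr0.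
- by exists (u + v); rewrite rmorphD opprD addrACA IHp IHq mulrDl.
- exists (u * q + subst_lin (proj_mx l w) p * v).
  rewrite rmorphM /= mulrDl mulrAC -IHp -mulrA -IHq.
  by move: (subst_lin _ p) (subst_lin _ q) => p' q'; ring.
Qed.

Lemma dual_lform (l : C * C) : l != (0, 0) -> exists w, l.1 * w.1 + l.2 * w.2 = 1.
Proof.
case: l => a b; rewrite xpair_eqE negb_and => /orP[a0|b0] /=.
  by exists (a^-1, 0); rewrite mulr0 addr0 mulfV.
by exists (0, b^-1); rewrite mulr0 add0r mulfV.
Qed.

Lemma divides_lformP l w f : l.1 * w.1 + l.2 * w.2 = 1 ->
  divides (lform l) f <-> subst_lin (proj_mx l w) f = 0.
Proof.
move=> lw; split=> [[r ->]|f0]; first by rewrite rmorphM /= subst_proj_lform ?mulr0.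
by have := divides_sub_proj l w f; rewrite f0 subr0.
Qed.

(** Divisibility by l is vanishing under a substitution, which is a ring morphism to
a domain. *)
Lemma lform_prime l p q : l != (0, 0) -> divides (lform l) (p * q) ->
  divides (lform l) p \/ divides (lform l) q.
Proof.
move=> /dual_lform[w lw] /(divides_lformP _ lw).
rewrite rmorphM /= => /eqP; rewrite mulf_eq0 => /orP[] /eqP h.
  by left; apply/(divides_lformP _ lw).
by right; apply/(divides_lformP _ lw).
Qed.

Definition kernel_point (l : C * C) (i : 'I_2) : C := if i == ord0 then l.2 else - l.1.

Lemma meval_lform l (v : 'I_2 -> C) : (lform l).@[v] = l.1 * v ord0 + l.2 * v ord_max.
Proof. by rewrite /lform mevalD !mevalZ !mevalXU. Qed.

(** A multiple of l vanishes at every zero of l. *)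
Lemma not_divides_lform l q : q.@[kernel_point l] != 0 -> ~ divides (lform l) q.
Proof.
move=> q0 [r qE]; move: q0; rewrite qE mevalM meval_lform /kernel_point /=.
by rewrite mulrN [l.2 * _]mulrC subrr mulr0 eqxx.
Qed.

Lemma lform_neq0 l : l != (0, 0) -> lform l != 0.
Proof.
move=> l0; apply/eqP=> L0; have [w lw] := dual_lform l0.
have := meval_lform l (fun i => if i == ord0 then w.1 else w.2).
by rewrite L0 meval0 /= lw => /esym/eqP; rewrite oner_eq0.
Qed.

Lemma lform_exp_prime l k q N : l != (0, 0) -> ~ divides (lform l) q ->
  divides (lform l ^+ k) (q * N) -> divides (lform l ^+ k) N.
Proof.
move=> l0 nq; elim: k => [|k IH] [r Er]; first by exists N; rewrite expr0 mulr1.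
have [|s Es] := IH; first by exists (r * lform l); rewrite Er exprS mulrA.
have : q * s = r * lform l.
  apply: (mulIf (expf_neq0 k (lform_neq0 l0))).
  by rewrite -mulrA -Es Er exprS mulrA.
move=> E; have [//|[t Et]] : divides (lform l) q \/ divides (lform l) s.
  by apply: lform_prime => //; exists r.
by exists t; rewrite Es Et exprS mulrA.
Qed.

(** One form at a time: the product of the remaining forms does not vanish at the
kernel point of l, so the prime l divides the cofactor. *)
Lemma prod_lform_exp (ls : seq (C * C)) k N :
  pairwise (fun l l' => l.2 * l'.1 != l.1 * l'.2) ls ->
  (forall l, l \in ls -> divides (lform l ^+ k) N) ->
  divides ((\prod_(l <- ls) lform l) ^+ k) N.
Proof.
elim: ls => [|l ls IH] /=; first by exists N; rewrite big_nil expr1n mulr1.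
move=> /andP[/allP l_ls pls] dN.
have [|r Er] := IH pls; first by move=> l' l'ls; apply: dN; rewrite inE l'ls orbT.
case: (ls =P [::]) => [ls0|/eqP].
  rewrite ls0 big_seq1; apply: dN; exact: mem_head.
rewrite -size_eq0 -lt0n -has_predT => /hasP[l1 /l_ls l1P _].
have l0 : l != (0, 0).
  by apply: contraNneq l1P => ->; rewrite /= !mul0r.
have [||s Es] := @lform_exp_prime l k ((\prod_(l <- ls) lform l) ^+ k) r l0.
- apply: not_divides_lform; rewrite rmorphXn rmorph_prod /= expf_neq0 //.
  rewrite prodf_seq_neq0; apply/allP => l' /l_ls l'P /=.
  rewrite meval_lform /kernel_point /= mulrN subr_eq0 mulrC [_ * l.1]mulrC //.
- by rewrite mulrC -Er; apply: dN; rewrite mem_head.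
by exists s; rewrite big_cons Er Es exprMn; ring.
Qed.

(** Restriction to the axis y = 0, the mirror of D. *)
Definition axis_mx : 'M[C]_2 := proj_mx (0, 1) (0, 1).

Lemma lform01 : lform (0, 1) = y.
Proof. by rewrite /lform /= scale0r add0r scale1r. Qed.

Lemma subst_axis_x : subst_lin axis_mx x = x.
Proof. by rewrite subst_proj_x /= scale0r subr0. Qed.

Lemma subst_axis_y : subst_lin axis_mx y = 0.
Proof. by rewrite subst_proj_y /= lform01 scale1r subrr. Qed.

Lemma divides_y f : divides y f <-> subst_lin axis_mx f = 0.
Proof. by rewrite -lform01; apply: divides_lformP; rewrite /= mul0r add0r mulr1. Qed.

Lemma subst_D_x : subst_lin (matD R) x = x.
Proof.
by rewrite subst_linx !mxE /= !(tnth_nth 0) /= scale1r scale0r addr0.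
Qed.

Lemma subst_D_y : subst_lin (matD R) y = 'i%C *: y.
Proof.
by rewrite subst_liny !mxE /= !(tnth_nth 0) /= scale0r add0r.
Qed.

Lemma matD_axis : matD R *m axis_mx = axis_mx.
Proof.
rewrite /matD /diagm mul_diag_mx; apply/matrixP=> i j; rewrite !mxE (tnth_nth 0).
by case: (ord2P i) => ->; case: (ord2P j) => -> /=; ring.
Qed.

Lemma subst_axis_D f : subst_lin axis_mx (subst_lin (matD R) f) = subst_lin axis_mx f.
Proof. by rewrite -[in RHS]matD_axis subst_linM. Qed.

Lemma X_neq0 (i : 'I_2) : 'X_i != 0 :> Cxy.
Proof. by rewrite -msize_poly_eq0 msizeX. Qed.

Lemma i_neq0 : 'i%C != 0 :> C.
Proof.
apply/eqP=> i0; have := sqr_i R; rewrite i0 expr0n /= => /esym/eqP.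
by rewrite oppr_eq0 oner_eq0.
Qed.

Lemma expi_neq1 e : (0 < e < 4)%N -> 'i%C ^+ e != 1 :> C.
Proof.
have m1 : -1 != 1 :> C.
  by rewrite -subr_eq0 -opprD oppr_eq0 -[1 + 1]/(2%:R) pnatr_eq0.
have i1 : 'i%C != 1 :> C by apply: contra_neq m1 => i1; rewrite -sqr_i i1 expr1n.
case: e => [|[|[|[|//]]]] // _; rewrite ?sqr_i //.
by apply: contra_neq i1 => i3; rewrite -expi4 exprSr i3 mul1r.
Qed.

(** D fixes the axis pointwise, so f = i^e f there and f vanishes on it if
0 < e < 4; dividing by y lowers e by one. *)
Lemma divides_y_exp e f : (e < 4)%N ->
  subst_lin (matD R) f = 'i%C ^+ e *: f -> divides (y ^+ e) f.
Proof.
elim: e f => [|e IH] f; first by exists f; rewrite expr0 mulr1.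
move=> e4 Df.
have /divides_y[g Eg] : subst_lin axis_mx f = 0.
  have := congr1 (subst_lin axis_mx) Df; rewrite subst_axis_D linearZ /=.
  move/eqP; rewrite -subr_eq0 -{1}[subst_lin _ _]scale1r -scalerBl scaler_eq0.
  case/orP=> [|/eqP//]; rewrite subr_eq0 eq_sym => h.
  by have := @expi_neq1 e.+1 e4; rewrite h.
have [|r Er] := IH g (ltnW e4); last by exists r; rewrite Eg Er exprSr mulrA.
have iy0 : 'i%C *: y != 0 by rewrite scaler_eq0 negb_or i_neq0 X_neq0.
apply: (mulIf iy0); rewrite -[in LHS]subst_D_y -rmorphM /= -Eg Df Eg exprS.
by rewrite -!mul_mpolyC rmorphM /=; ring.
Qed.

End LinearSubstitutions.

(** * Semi-invariants and the six mirrors *)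

Section SemiInvariants.
Variable R : realType.
Local Notation C := R[i].
Local Notation Cxy := {mpoly C[2]}.
Local Notation x := ('X_ord0 : Cxy).
Local Notation y := ('X_ord_max : Cxy).
Local Notation T := (matT R).
Local Notation D := (matD R).
Local Opaque subst_lin kappa.
Local Notation lift := (map_mx (fun c : C => c%:MP_[2])).

Lemma groupG_unit (g : 'M[C]_2) : groupG g -> g \in unitmx.
Proof.
elim=> [||||] *; rewrite ?unitmx1 ?unitmx_inv ?unitmx_mul //; last exact/andP.
  have : T *m T \in unitmx by rewrite sqr_matT unitmxE det_scalar unitfE expf_neq0 ?i_neq0.
  by rewrite unitmx_mul => /andP[].
rewrite unitmxE det_diag unitfE big_ord_recl big_ord1 !mxE !(tnth_nth 0) /=.
by rewrite mul1r i_neq0.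
Qed.

Definition vertex_poly : Cxy := vertex_form x y.

(** The coefficients of the six mirror forms y, x, x - y, x - iy, x + y, x + iy. *)
Definition reflection_lines : seq (C * C) :=
  [:: (0, 1); (1, 0); (1, -1); (1, - 'i%C); (1, 1); (1, 'i%C)].

Lemma prod_reflection_lines : \prod_(l <- reflection_lines) lform l = - vertex_poly.
Proof.
rewrite /reflection_lines !big_cons big_nil /lform /= -!mul_mpolyC !mpolyCN !mpolyC0 !mpolyC1.
have i2 : ('i%C)%:MP_[2] ^+ 2 = -1 :> Cxy by rewrite -rmorphXn /= sqr_i mpolyCN mpolyC1.
rewrite /vertex_poly /vertex_form; move: ('i%C)%:MP_[2] i2 => I i2.
transitivity (x * y * (x ^+ 2 - y ^+ 2) * (x ^+ 2 - I ^+ 2 * y ^+ 2)); first by ring.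
by rewrite i2; ring.
Qed.

Lemma subst_T_x : subst_lin T x = kappa R *: (x + y).
Proof. by rewrite subst_linx matTE !mxE /= scalerDr. Qed.

Lemma subst_T_y : subst_lin T y = kappa R *: (x - y).
Proof. by rewrite subst_liny matTE !mxE /= scalerBr scaleNr. Qed.

Lemma kappa_neq0 : kappa R != 0.
Proof.
apply/eqP=> k0; have := kappa4 R; rewrite k0 expr0n mul0r => /esym/eqP.
by rewrite oppr_eq0 oner_eq0.
Qed.

Lemma vertex_poly_neq0 : vertex_poly != 0.
Proof.
rewrite -oppr_eq0 -prod_reflection_lines prodf_seq_neq0; apply/allP => l /=.
rewrite /reflection_lines !inE => lP; apply: lform_neq0.
by move: lP => /or4P[|||/or3P[]] /eqP->; rewrite xpair_eqE ?oner_eq0 ?andbF.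
Qed.

Local Opaque vertex_poly.

Lemma pairwise_reflection_lines :
  pairwise (fun l l' : C * C => l.2 * l'.1 != l.1 * l'.2) reflection_lines.
Proof.
have n2 : 1 + 1 != 0 :> C by rewrite -[1 + 1]/(2%:R) pnatr_eq0.
have i0 := i_neq0 R.
have i1 : 'i%C != 1 :> C by apply: (@expi_neq1 R 1).
have i3 : 'i%C != -1 :> C.
  apply: contra_neq (@expi_neq1 R 2 isT) => ->; by rewrite sqrrN expr1n.
rewrite /reflection_lines /= !(mulr1, mul1r, mul0r, mulr0) !(oner_eq0, eq_sym 0 1, oppr_eq0) /=.
move: i0 i1 i3 n2; move: ('i%C) => I i0 i1 i3 n2.
have i2 : - I != I by rewrite eq_sym -subr_eq0 opprK -mulr2n -mulr_natr mulf_neq0.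
have m1 : -1 != 1 :> C by rewrite eq_sym -subr_eq0 opprK.
rewrite !(eq_sym 0) !oppr_eq0 oner_eq0 i0 i2 m1 eqr_opp (eq_sym 1) i1.
by rewrite (eq_sym (-1)) i3 eqr_oppLR i3.
Qed.

Lemma subst_mulD_y (g : 'M[C]_2) c b : subst_lin g y = c *: (x + b *: y) ->
  subst_lin (g *m D) y = c *: (x + (b * 'i%C) *: y).
Proof.
by move=> Eg; rewrite subst_linM Eg linearZ linearD linearZ /= subst_D_x subst_D_y scalerA.
Qed.

(** The form y is carried to the others by 1, T D^2 T, T, T D, T D^2 and T D^3. *)
Lemma orbit_reflection_lines l : l \in reflection_lines ->
  exists g c, [/\ groupG g, c != 0 & subst_lin g y = c *: lform l].
Proof.
have i2 : 'i%C * 'i%C = -1 :> C by rewrite -expr2 sqr_i.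
have GT := groupG_T R; have GD := groupG_D R; have k0 := kappa_neq0.
have E1 : subst_lin T y = kappa R *: (x + -1 *: y) by rewrite subst_T_y scaleN1r.
have := subst_mulD_y E1; rewrite mulN1r => E2.
have := subst_mulD_y E2; rewrite mulNr i2 opprK => E3.
have := subst_mulD_y E3; rewrite mul1r => E4.
rewrite !inE => /or4P[/eqP->|/eqP->|/eqP->|/or3P[]/eqP->];
  rewrite /lform /= ?scale0r ?addr0 ?add0r 1?[1 *: x]scale1r.
- by exists 1%:M, 1; split; [apply: groupG_1|apply: oner_neq0|rewrite subst_lin1 !scale1r].
- exists (T *m D *m D *m T), 'i%C; split; [by do !apply: groupG_M|apply: i_neq0|].
  rewrite subst_linM E3 [1 *: y]scale1r linearZ linearD /= subst_T_x subst_T_y.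
  rewrite -scalerDr addrACA subrr addr0 scalerA -sqr_kappa.
  by rewrite -mulr2n -scaler_nat scalerA mulr_natr.
- by exists T, (kappa R); split; [exact: GT|exact: k0|exact: E1].
- by exists (T *m D), (kappa R); split; [exact: groupG_M|exact: k0|exact: E2].
- exists (T *m D *m D), (kappa R); split; [by do !apply: groupG_M|exact: k0|].
  by rewrite E3 [1 *: y]scale1r.
- by exists (T *m D *m D *m D), (kappa R); split; [do !apply: groupG_M|exact: k0|exact: E4].
Qed.

(** The group carries the divisor y^k of N to the k-th powers of all six mirror forms,
while N only changes by constants. *)
Lemma semi_invariant_dvd k (N : Cxy) : divides (y ^+ k) N ->
  (forall g, groupG g -> exists2 c, c != 0 & subst_lin g N = c *: N) ->
  divides (vertex_poly ^+ k) N.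
Proof.
move=> [r Er] Ninv; apply: divides_expN; rewrite -prod_reflection_lines.
apply: prod_lform_exp pairwise_reflection_lines _ => l /orbit_reflection_lines[g [c [Gg c0 Eg]]].
have [d d0 Ed] := Ninv _ Gg.
apply: (@divides_units _ k _ _ c%:MP d%:MP (d^-1)%:MP).
  by rewrite -mpolyCM mulVf // mpolyC1.
rewrite !mul_mpolyC -Ed -Eg; exists (subst_lin g r).
by rewrite {}Er rmorphM rmorphXn.
Qed.

(** At D, row r is multiplied by i^(e_r), hence divisible by y^(e_r); the determinant
is a semi-invariant with multiplier det rho(g). *)
Lemma vvinv_det_dvd m (rho : 'M[C]_2 -> 'M[C]_m) (e : 'I_m -> nat) (M : 'M[Cxy]_m) :
  is_representation rho ->
  rho D = diag_mx (\row_r 'i%C ^+ e r) -> (forall r, e r < 4)%N ->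
  (forall g, groupG g -> map_mx (subst_lin g) M = lift (rho g) *m M) ->
  divides (vertex_poly ^+ (\sum_r e r)) (\det M).
Proof.
move=> [rho_unit _] rhoD e4 Minv; apply: semi_invariant_dvd => [|g Gg]; last first.
  exists (\det (rho g)); first by have := rho_unit _ Gg; rewrite unitmxE unitfE.
  by rewrite -det_map_mx Minv // det_mulmx det_map_mx mul_mpolyC.
have dM i j : divides (y ^+ e i) (M i j).
  apply: divides_y_exp => //.
  have /matrixP/(_ i j) := Minv _ (groupG_D R).
  rewrite rhoD mxE => ->; rewrite map_diag_mx mul_diag_mx !mxE.
  by rewrite mul_mpolyC.
have {}dM i j : exists r, M i j = y ^+ e i * r.
  by have [r ->] := dM i j; exists r; rewrite mulrC.
pose M' := \matrix_(i, j) projT1 (cid (dM i j)).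
have -> : M = diag_mx (\row_i y ^+ e i) *m M'.
  by apply/matrixP=> i j; rewrite mul_diag_mx !mxE; case: cid.
rewrite det_mulmx det_diag; exists (\det M'); rewrite mulrC; congr (_ * _).
by rewrite expr_sum; apply: eq_bigr => i _; rewrite mxE.
Qed.

(** * The free basis criterion *)

Lemma lift_mulmx m n p (A : 'M[C]_(m, n)) (B : 'M[C]_(n, p)) : lift (A *m B) = lift A *m lift B.
Proof. exact: map_mxM. Qed.

Lemma map_subst_linM m n (g h : 'M[C]_2) (F : 'M[Cxy]_(m, n)) :
  map_mx (subst_lin (g *m h)) F = map_mx (subst_lin h) (map_mx (subst_lin g) F).
Proof.
by apply/matrixP=> i j; rewrite [LHS]mxE [RHS]mxE [in RHS]mxE subst_linM.
Qed.

Lemma map_subst_lin1 m n (F : 'M[Cxy]_(m, n)) : map_mx (subst_lin 1%:M) F = F.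
Proof. by apply/matrixP=> i j; rewrite [LHS]mxE subst_lin1. Qed.

Lemma map_subst_lift m n (g : 'M[C]_2) (A : 'M[C]_(m, n)) :
  map_mx (subst_lin g) (lift A) = lift A.
Proof. by apply/matrixP=> i j; rewrite [LHS]mxE !mxE subst_linC. Qed.

Lemma vvinv_of_TD m (A B : 'M[C]_m) rho F : representation_with_values A B rho ->
  map_mx (subst_lin T) F = lift A *m F -> map_mx (subst_lin D) F = lift B *m F ->
  vvinv rho F.
Proof.
move=> [[rho_unit rhoM] <- <-] FT FD.
pose acts g := map_mx (subst_lin g) F = lift (rho g) *m F.
apply: (@groupG_monoid_ind R acts FT FD) => [|g h Gg Gh Fg Fh]; rewrite /acts.
  have G1 := groupG_1 R.
  have -> : rho 1%:M = 1%:M.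
    have u1 := rho_unit _ G1.
    by rewrite -[LHS](mulKmx u1) -rhoM // mulmx1 mulVmx.
  by rewrite map_scalar_mx /= mpolyC1 mul1mx map_subst_lin1.
rewrite (rhoM _ _ Gg Gh) lift_mulmx map_subst_linM.
exact: map_mx_comp_acts Fg Fh (map_subst_lift h _).
Qed.

Definition gens_mx m (b : m.-tuple 'cV[Cxy]_m) : 'M[Cxy]_m := \matrix_(i, j) tnth b j i ord0.

Lemma lincomb_gens_mx m (b : m.-tuple 'cV[Cxy]_m) (c : 'I_m -> Cxy) :
  \sum_j c j *: tnth b j = gens_mx b *m \col_j c j.
Proof.
apply/matrixP=> i k; rewrite summxE mxE; apply: eq_bigr => j _.
by rewrite !mxE mulrC (ord1 k).
Qed.

Lemma subst_gens_mx m (b : m.-tuple 'cV[Cxy]_m) g (A : 'M[Cxy]_m) :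
  map_mx (subst_lin g) (gens_mx b) = A *m gens_mx b <->
  (forall j, map_mx (subst_lin g) (tnth b j) = A *m tnth b j).
Proof.
split=> [/matrixP E j|E]; apply/matrixP=> i k.
  rewrite (ord1 k); have := E i j; rewrite !mxE => ->.
  by apply: eq_bigr => l _; rewrite mxE.
have /matrixP/(_ i ord0) := E k; rewrite !mxE => ->.
by apply: eq_bigr => l _; rewrite mxE.
Qed.

Lemma lift_inj_mul m (A A' : 'M[C]_m) (B : 'M[Cxy]_m) : \det B != 0 ->
  lift A *m B = lift A' *m B -> A = A'.
Proof.
move=> B0 /(mulmx_det_neq0_inj B0) /matrixP E; apply/matrixP => i j.
by have := E i j; rewrite !mxE => /(can_inj (@mpolyCK _ _)).
Qed.

(** For each g there is a constant matrix A with B(gx) = A B(x), a product of the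
given ones; it is unique because det B is nonzero, and uniqueness makes it
multiplicative in g. *)
Lemma exists_representation m (A_T A_D : 'M[C]_m) (B : 'M[Cxy]_m) : \det B != 0 ->
  map_mx (subst_lin T) B = lift A_T *m B -> map_mx (subst_lin D) B = lift A_D *m B ->
  exists rho, representation_with_values A_T A_D rho.
Proof.
move=> detB BT BD.
pose acts g A := map_mx (subst_lin g) B = lift A *m B.
have {}BT : acts T A_T by exact: BT.
have {}BD : acts D A_D by exact: BD.
have actsM g h A A' : acts g A -> acts h A' -> acts (g *m h) (A *m A').
  move=> Eg Eh; rewrite /acts lift_mulmx map_subst_linM.
  exact: map_mx_comp_acts Eg Eh (map_subst_lift h _).
have acts1 : acts 1%:M 1%:M.
  by rewrite /acts map_scalar_mx /= mpolyC1 mul1mx map_subst_lin1.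
have acts_uniq g A A' : acts g A -> acts g A' -> A = A'.
  by rewrite /acts => -> /(lift_inj_mul detB).
have acts_ex g : groupG g -> exists A, acts g A.
  move: g; apply: (@groupG_monoid_ind R (fun g => exists A, acts g A)).
  - by exists A_T.
  - by exists A_D.
  - by exists 1%:M.
  - by move=> g h _ _ [A Eg] [A' Eh]; exists (A *m A'); apply: actsM.
pose rho g := if pselect (exists A, acts g A) is left ex then projT1 (cid ex) else 1%:M.
have rhoP g : groupG g -> acts g (rho g).
  move=> /acts_ex ex; rewrite /rho; case: pselect => [ex'|nex]; last by case: nex.
  exact: (projT2 (cid ex')).
have rhoM g h : groupG g -> groupG h -> rho (g *m h) = rho g *m rho h.
  move=> Gg Gh; apply: (acts_uniq _ _ _ (rhoP _ (groupG_M Gg Gh))).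
  exact: actsM (rhoP _ Gg) (rhoP _ Gh).
exists rho; split; last 2 first.
- exact: (acts_uniq _ _ _ (rhoP _ (groupG_T R)) BT).
- exact: (acts_uniq _ _ _ (rhoP _ (groupG_D R)) BD).
split; [move=> g Gg|exact: rhoM].
have : rho g *m rho (invmx g) = 1%:M.
  rewrite -(rhoM _ _ Gg (groupG_V Gg)) (mulmxV (groupG_unit Gg)).
  exact: (acts_uniq _ _ _ (rhoP _ (groupG_1 R)) acts1).
move=> E; exact: (mulmx1_unit E).1.
Qed.

Lemma vvinv_comb m rho (b : m.-tuple 'cV[Cxy]_m) (c : 'I_m -> Cxy) :
  (forall j, vvinv rho (tnth b j)) -> (forall j, Defs.invariant (c j)) ->
  vvinv rho (\sum_j c j *: tnth b j).
Proof.
move=> bP cP g Gg; rewrite lincomb_gens_mx map_mxM mulmxA.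
have /subst_gens_mx -> : forall j, map_mx (subst_lin g) (tnth b j) = lift (rho g) *m tnth b j.
  by move=> j; apply: bP.
congr (_ *m _); apply/matrixP=> i j; rewrite [LHS]mxE [in LHS]mxE [RHS]mxE.
exact: cP.
Qed.

(** Cramer's rule: the numerators are divisible by J^E, hence by det B, and they have
the same multiplier det rho(g) as det B, so that the quotients are invariant. *)
Lemma free_basis_criterion m (rho : 'M[C]_2 -> 'M[C]_m) (b : m.-tuple 'cV[Cxy]_m)
    (e : 'I_m -> nat) (c : C) :
  is_representation rho ->
  rho D = diag_mx (\row_r 'i%C ^+ e r) -> (forall r, e r < 4)%N ->
  (forall j, vvinv rho (tnth b j)) -> c != 0 ->
  \det (gens_mx b) = c *: vertex_poly ^+ (\sum_r e r) ->
  free_basis rho b.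
Proof.
move=> rho_rep rhoD e4 bP c0 detb.
have B0 : \det (gens_mx b) != 0 by rewrite {}detb scaler_eq0 negb_or c0 expf_neq0 ?vertex_poly_neq0.
have BP g : groupG g -> map_mx (subst_lin g) (gens_mx b) = lift (rho g) *m gens_mx b.
  by move=> Gg; apply/subst_gens_mx => j; apply: bP.
split=> [//|F FP|d _ d0 j].
  have MP j g : groupG g -> map_mx (subst_lin g) (replace_col (gens_mx b) F j) =
      lift (rho g) *m replace_col (gens_mx b) F j.
    by move=> Gg; apply: replace_col_acts; [apply: BP|apply: FP].
  have /choice[a aP] : forall j, exists a,
      \det (replace_col (gens_mx b) F j) = \det (gens_mx b) * a.
    move=> j; have [r ->] := vvinv_det_dvd rho_rep rhoD e4 (MP j).
    exists (c^-1 *: r); rewrite {}detb -scalerAl -scalerAr scalerA mulfV // scale1r.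
    exact: mulrC.
  exists a => [j g Gg|]; last first.
    by rewrite lincomb_gens_mx; apply: cramer_quotient B0 aP.
  have detP (M : 'M[Cxy]_m) : map_mx (subst_lin g) M = lift (rho g) *m M ->
      subst_lin g (\det M) = (\det (rho g))%:MP * \det M.
    by move=> E; rewrite -det_map_mx {}E det_mulmx det_map_mx.
  apply: (quotient_fixed B0 _ (aP j) (detP _ (BP g Gg)) (detP _ (MP j g Gg))).
  by rewrite mpolyC_eq0; have := rho_rep.1 _ Gg; rewrite unitmxE unitfE.
move: d0; rewrite lincomb_gens_mx => d0.
have /matrixP/(_ j ord0) : \col_j d j = 0.
  by apply: (mulmx_det_neq0_injl B0); rewrite mulmx0.
by rewrite !mxE.
Qed.

End SemiInvariants.

(** * Homogeneous components *)

Section Homog.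
Variables (n : nat) (A : comNzRingType).
Implicit Types f g : {mpoly A[n]}.

Lemma pihomogM d k f g : f \is d.-homog ->
  pihomog mdeg k (f * g) = if (d <= k)%N then f * pihomog mdeg (k - d) g else 0.
Proof.
move=> fa; have [N gN kN] : exists2 N, (msize g <= N)%N & (k < N)%N.
  by exists (maxn (msize g) k.+1); rewrite leq_max leqnn ?orbT.
rewrite {1}(pihomog_partitionE gN) mulr_sumr linear_sum /=.
have term (e : 'I_N) : pihomog mdeg k (f * pihomog mdeg e g) =
    if (d + e == k)%N then f * pihomog mdeg e g else 0.
  have fgd : f * pihomog mdeg e g \is (d + e).-homog.
    by apply: dhomogM => //; apply: pihomogP.
  case: eqP => [<-|/eqP ne]; first exact: pihomog_dE.
  exact: pihomog_ne0 fgd.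
rewrite (eq_bigr _ (fun e _ => term e)) -big_mkcond /=.
case: leqP => [ak|ka]; last first.
  by rewrite big1 // => e /eqP E; move: ka; rewrite -E ltnNge leq_addr.
have lt : (k - d < N)%N by apply: leq_ltn_trans kN; apply: leq_subr.
rewrite (big_pred1 (Ordinal lt)) // => e /=; rewrite -val_eqE /=.
by rewrite -[in RHS](eqn_add2l d) subnKC.
Qed.

Lemma dhomog0_const f : f \is 0.-homog -> exists c, f = c%:MP.
Proof.
move=> /dhomogP f0; exists f@_0; apply/mpolyP => m; rewrite mcoeffC.
case: (eqVneq m 0%MM) => [->|m0]; first by rewrite mulr1.
rewrite mulr0; apply/eqP; apply: contraNT m0.
by rewrite -mcoeff_msupp => /f0 /eqP; rewrite mdeg_eq0.
Qed.

Lemma homogX (i : 'I_n) : ('X_i : {mpoly A[n]}) \is 1.-homog.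
Proof. by rewrite dhomogX /= mdeg1. Qed.

Lemma homogC (c : A) : (c%:MP : {mpoly A[n]}) \is 0.-homog.
Proof. by rewrite -[_%:MP]mulr1 mul_mpolyC rpredZ // dhomog1. Qed.

Lemma homog_nat k : (k%:R : {mpoly A[n]}) \is 0.-homog.
Proof. by rewrite -mpolyC_nat homogC. Qed.

Lemma homogD k f g : f \is k.-homog -> g \is k.-homog -> f + g \is k.-homog.
Proof. exact: rpredD. Qed.

Lemma homogN k f : f \is k.-homog -> - f \is k.-homog.
Proof. by rewrite rpredN. Qed.

Lemma homogM_eq d e k f g : f \is d.-homog -> g \is e.-homog ->
  (d + e)%N = k -> f * g \is k.-homog.
Proof. by move=> fd ge <-; apply: dhomogM. Qed.

Lemma homogXn_eq d k l f : f \is d.-homog -> (d * k)%N = l -> f ^+ k \is l.-homog.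
Proof. by move=> fd <-; apply: dhomogMn. Qed.

End Homog.

(** The degree of a homogeneous expression is read off its syntax, following the first
summand of every sum. *)
Ltac poly_degree t := lazymatch t with
  | ?f + _ => poly_degree f
  | - ?f => poly_degree f
  | ?f * ?g => let a := poly_degree f in let b := poly_degree g in constr:((a + b)%N)
  | ?f ^+ ?k => let a := poly_degree f in constr:((a * k)%N)
  | _%:R => constr:(0%N)
  | _ => constr:(1%N)
  end.

Ltac solve_homog := lazymatch goal with
  | |- is_true (_ + _ \is _) => apply: homogD; solve_homog
  | |- is_true (- _ \is _) => apply: homogN; solve_homog
  | |- is_true (?f * ?g \is _) =>
      let a := poly_degree f in let b := poly_degree g in
      apply: (@homogM_eq _ _ a b); [solve_homog|solve_homog|reflexivity]
  | |- is_true (?f ^+ ?k \is _) =>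
      let a := poly_degree f in apply: (@homogXn_eq _ _ a); [solve_homog|reflexivity]
  | |- is_true (_%:R \is _) => exact: homog_nat
  | _ => exact: homogX
  end.

(** * The ring of invariants *)

Section Invariants.
Variable R : realType.
Local Notation C := R[i].
Local Notation Cxy := {mpoly C[2]}.
Local Notation x := ('X_ord0 : Cxy).
Local Notation y := ('X_ord_max : Cxy).
Local Notation T := (matT R).
Local Notation D := (matD R).
Local Notation J := (vertex_poly R).
Local Opaque subst_lin kappa.

Lemma invariant_of_TD (f : Cxy) : subst_lin T f = f -> subst_lin D f = f -> Defs.invariant f.
Proof.
move=> fT fD; apply: (@groupG_monoid_ind R (fun g => subst_lin g f = f) fT fD).
  exact: subst_lin1.
by move=> g h _ _ Eg Eh; rewrite subst_linM Eg.
Qed.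

Lemma kappaMP4 : (kappa R)%:MP_[2] ^+ 4 * 4%:R = -1 :> Cxy.
Proof. by rewrite -rmorphXn /= -mpolyC_nat -mpolyCM kappa4 mpolyCN mpolyC1. Qed.

Definition face_poly : Cxy := face_form x y.
Definition edge_poly : Cxy := edge_form x y.

Lemma expi4MP : ('i%C)%:MP_[2] ^+ 4 = 1 :> Cxy.
Proof. by rewrite -rmorphXn /= expi4 mpolyC1. Qed.

Lemma subst_T_xM : subst_lin T x = (kappa R)%:MP * (x + y).
Proof. by rewrite mul_mpolyC subst_T_x. Qed.

Lemma subst_T_yM : subst_lin T y = (kappa R)%:MP * (x - y).
Proof. by rewrite mul_mpolyC subst_T_y. Qed.

Lemma subst_D_yM : subst_lin D y = ('i%C)%:MP * y.
Proof. by rewrite mul_mpolyC subst_D_y. Qed.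

Lemma subst_vertex_poly (g : 'M[C]_2) u v : subst_lin g x = u -> subst_lin g y = v ->
  subst_lin g J = vertex_form u v.
Proof. by move=> <- <-; exact: (@rmorph_vertex_form Cxy Cxy (subst_lin g)). Qed.

Lemma subst_face_poly (g : 'M[C]_2) u v : subst_lin g x = u -> subst_lin g y = v ->
  subst_lin g face_poly = face_form u v.
Proof. by move=> <- <-; exact: (@rmorph_face_form Cxy Cxy (subst_lin g)). Qed.

Lemma subst_edge_poly (g : 'M[C]_2) u v : subst_lin g x = u -> subst_lin g y = v ->
  subst_lin g edge_poly = edge_form u v.
Proof. by move=> <- <-; exact: (@rmorph_edge_form Cxy Cxy (subst_lin g)). Qed.

Lemma face_poly_invariant : Defs.invariant face_poly.
Proof.
apply: invariant_of_TD.
  by rewrite (subst_face_poly subst_T_xM subst_T_yM); apply/face_form_T/kappaMP4.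
by rewrite (subst_face_poly (subst_D_x R) subst_D_yM); apply/face_form_D/expi4MP.
Qed.

Lemma edge_poly_invariant : Defs.invariant edge_poly.
Proof.
apply: invariant_of_TD.
  by rewrite (subst_edge_poly subst_T_xM subst_T_yM); apply/edge_form_T/kappaMP4.
by rewrite (subst_edge_poly (subst_D_x R) subst_D_yM); apply/edge_form_D/expi4MP.
Qed.

Lemma vertex_poly_T : subst_lin T J = - 'i%C *: J.
Proof.
rewrite (subst_vertex_poly subst_T_xM subst_T_yM) (vertex_form_T _ _ kappaMP4) -mul_mpolyC.
by congr (_ * _); rewrite mpolyCN -[in RHS]sqr_kappa mpolyCMn (mpolyCM _ (kappa R)).
Qed.

Lemma vertex_poly_D : subst_lin D J = 'i%C *: J.
Proof.
rewrite (subst_vertex_poly (subst_D_x R) subst_D_yM) (vertex_form_D _ _ expi4MP).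
exact: mul_mpolyC.
Qed.

Lemma vertex_poly4_invariant : Defs.invariant (J ^+ 4).
Proof.
apply: invariant_of_TD; rewrite rmorphXn /=;
  rewrite ?vertex_poly_T ?vertex_poly_D exprZn ?(exprM _ 2 2) ?sqrrN sqr_i.
  by rewrite sqrrN expr1n scale1r.
by rewrite sqrrN expr1n scale1r.
Qed.

Lemma homog_axis n (f : Cxy) : f \is n.-homog ->
  exists c, subst_lin (axis_mx R) f = c *: x ^+ n.
Proof.
move=> /dhomogP fn.
exists (\sum_(m <- msupp f) if m ord_max == 0%N then f@_m else 0).
rewrite {1}[f]mpolyE linear_sum scaler_suml; apply: eq_big_seq => m /fn mn.
rewrite linearZ /=; rewrite mpolyXE_id big_ord_recl big_ord1.
rewrite (_ : lift ord0 ord0 = ord_max :> 'I_2); last exact/val_inj.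
rewrite rmorphM /= !rmorphXn /= subst_axis_x subst_axis_y.
have {}mn : mdeg m = n by exact: mn.
move: mn; rewrite mdegE big_ord_recl big_ord1.
rewrite (_ : lift ord0 ord0 = ord_max :> 'I_2); last exact/val_inj.
case: (m ord_max) => [|k] mn; first by rewrite -mn expr0 addn0 mulr1.
by rewrite expr0n mulr0 scaler0 scale0r.
Qed.

Lemma meval_subst g (f : Cxy) (v : 'I_2 -> C) :
  (subst_lin g f).@[v] = f.@[fun i => \sum_j g i j * v j].
Proof.
elim/mpoly2_ind: f => [c|||p q IHp IHq|p q IHp IHq].
- by rewrite subst_linC !mevalC.
- rewrite subst_linx mevalD !mevalZ !mevalXU big_ord_recl big_ord1.
  by rewrite (_ : lift ord0 ord0 = ord_max :> 'I_2); last exact/val_inj.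
- rewrite subst_liny mevalD !mevalZ !mevalXU big_ord_recl big_ord1.
  by rewrite (_ : lift ord0 ord0 = ord_max :> 'I_2); last exact/val_inj.
- by rewrite rmorphD /= !mevalD; apply: congr2 IHp IHq.
- by rewrite rmorphM /= !mevalM; apply: congr2 IHp IHq.
Qed.

Lemma face_poly_homog : face_poly \is 8.-homog.
Proof. by rewrite /face_poly /face_form; solve_homog. Qed.

Lemma edge_poly_homog : edge_poly \is 12.-homog.
Proof. by rewrite /edge_poly /edge_form; solve_homog. Qed.

Lemma vertex_poly4_homog : J ^+ 4 \is 24.-homog.
Proof. by rewrite /vertex_poly /vertex_form; solve_homog. Qed.

Lemma subst_lin_homog (g : 'M[C]_2) d (f : Cxy) : f \is d.-homog -> subst_lin g f \is d.-homog.
Proof.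
move=> /dhomogP fd; rewrite [f]mpolyE linear_sum big_seq; apply: rpred_sum => m /fd md.
rewrite linearZ /=; apply: rpredZ; rewrite mpolyXE_id big_ord_recl big_ord1 rmorphM !rmorphXn /=.
have {}md : mdeg m = d by exact: md.
have lin i : subst_lin g 'X_i \is 1.-homog.
  by case: (ord2P i) => ->; rewrite ?subst_linx ?subst_liny;
    apply: rpredD; apply: rpredZ; apply: homogX.
apply: homogM_eq; [exact: dhomogMn (lin _)|exact: dhomogMn (lin _)|].
by rewrite -md mdegE big_ord_recl big_ord1 !mul1n.
Qed.

Lemma pihomog_subst (g : 'M[C]_2) d (f : Cxy) :
  pihomog mdeg d (subst_lin g f) = subst_lin g (pihomog mdeg d f).
Proof.
have sumP N (F : 'I_N -> Cxy) : (forall e, F e \is (e : nat).-homog) ->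
    pihomog mdeg d (subst_lin g (\sum_e F e)) = subst_lin g (pihomog mdeg d (\sum_e F e)).
  move=> FP; rewrite (linear_sum (subst_lin g)) !(linear_sum (pihomog mdeg d)).
  rewrite (linear_sum (subst_lin g)); apply: eq_bigr => e _ /=.
  have sFe := subst_lin_homog g (FP e).
  case: (eqVneq (e : nat) d) => [<-|ed]; first by rewrite !pihomog_dE.
  by rewrite (pihomog_ne0 ed sFe) (pihomog_ne0 ed (FP e)) linear0.
have := sumP (mmeasure mdeg f) (fun e => pihomog mdeg e f) (fun e => pihomogP mdeg e f).
by rewrite -(pihomog_partitionE (leqnn (mmeasure mdeg f))).
Qed.

Lemma pihomog_invariant d (f : Cxy) : Defs.invariant f -> Defs.invariant (pihomog mdeg d f).
Proof. by move=> finv g Gg; rewrite -pihomog_subst finv. Qed.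

Lemma invariantD (f g : Cxy) : Defs.invariant f -> Defs.invariant g -> Defs.invariant (f + g).
Proof. by move=> fi gi u Gu; rewrite linearD /= (fi _ Gu) (gi _ Gu). Qed.

Lemma invariantZ c (f : Cxy) : Defs.invariant f -> Defs.invariant (c *: f).
Proof. by move=> fi u Gu; rewrite linearZ /= (fi _ Gu). Qed.

Lemma invariantM (f g : Cxy) : Defs.invariant f -> Defs.invariant g -> Defs.invariant (f * g).
Proof. by move=> fi gi u Gu; rewrite rmorphM /= (fi _ Gu) (gi _ Gu). Qed.

Lemma invariantXn k (f : Cxy) : Defs.invariant f -> Defs.invariant (f ^+ k).
Proof. by move=> fi u Gu; rewrite rmorphXn /= (fi _ Gu). Qed.

Lemma vertex_poly4_neq0 : J ^+ 4 != 0.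
Proof. by rewrite expf_neq0 ?vertex_poly_neq0. Qed.

Lemma invariant_quotient (g : Cxy) : Defs.invariant (J ^+ 4 * g) -> Defs.invariant g.
Proof.
move=> Ji u Gu; have := Ji _ Gu.
by rewrite rmorphM /= (vertex_poly4_invariant Gu) => /(mulfI vertex_poly4_neq0).
Qed.

(** The cofactor of y has D-multiplier i^(-1) = i^3, and so contains y^3. *)
Lemma subst_D_dvd_y4 (f : Cxy) : subst_lin D f = f -> subst_lin (axis_mx R) f = 0 ->
  divides (y ^+ 4) f.
Proof.
move=> Df /divides_y [r Er].
have Dr : subst_lin D r = 'i%C ^+ 3 *: r.
  have iy0 : 'i%C *: y != 0 by rewrite scaler_eq0 negb_or i_neq0 X_neq0.
  apply: (mulIf iy0); rewrite -[in LHS]subst_D_y -[LHS]rmorphM /=.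
  rewrite -Er {}Df Er -scalerAr -scalerAl scalerA -exprS expi4.
  by rewrite scale1r.
have [s Es] := divides_y_exp (isT : 3 < 4)%N Dr.
by exists s; rewrite {}Er {}Es -mulrA -exprSr.
Qed.

Lemma invariant_axis0_dvd (f : Cxy) : Defs.invariant f -> subst_lin (axis_mx R) f = 0 ->
  exists g, f = J ^+ 4 * g.
Proof.
move=> finv f0; have y4 := subst_D_dvd_y4 (finv _ (groupG_D R)) f0.
have [|t Et] := semi_invariant_dvd y4.
  by move=> g Gg; exists 1; rewrite ?oner_neq0 // scale1r finv.
by exists t; rewrite mulrC.
Qed.

(** The kernel of the restriction to the axis in degree n is J^4 times the invariants of
degree n - 24. *)
Lemma invariant_axis0_quotient n (f : Cxy) : Defs.invariant f -> f \is n.-homog ->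
  subst_lin (axis_mx R) f = 0 ->
  if (24 <= n)%N then exists g, [/\ f = J ^+ 4 * g, Defs.invariant g & g \is (n - 24).-homog]
  else f = 0.
Proof.
move=> finv fn f0; have [r Er] := invariant_axis0_dvd finv f0.
have := pihomogM n r vertex_poly4_homog; rewrite -Er (pihomog_dE fn).
case: ifP => // n24 Ef; exists (pihomog mdeg (n - 24) r); split=> //.
  by apply: invariant_quotient; rewrite -Ef.
exact: pihomogP.
Qed.

End Invariants.

(** * A graded basis of the invariants *)

Section InvariantBasis.
Variable R : realType.
Local Notation C := R[i].
Local Notation Cxy := {mpoly C[2]}.
Local Notation x := ('X_ord0 : Cxy).
Local Notation y := ('X_ord_max : Cxy).
Local Notation T := (matT R).
Local Notation D := (matD R).
Local Notation J := (vertex_poly R).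
Local Opaque subst_lin kappa.

Lemma expi_eq1 n : 'i%C ^+ n = 1 :> C -> (4 %| n)%N.
Proof.
rewrite {1}(divn_eq n 4) exprD mulnC exprM expi4 expr1n mul1r => E.
rewrite /dvdn; apply/negPn/negP => n4.
by have := @expi_neq1 R (n %% 4); rewrite E eqxx lt0n n4 ltn_pmod //= => /(_ isT).
Qed.

(** The scalar matrix T^2 = i multiplies x^n by i^n. *)
Lemma invariant_axis_degree n (f : Cxy) c : Defs.invariant f ->
  subst_lin (axis_mx R) f = c *: x ^+ n -> c != 0 -> (4 %| n)%N.
Proof.
move=> finv fc c0; apply: expi_eq1.
have GS : groupG ('i%C%:M : 'M[C]_2) by rewrite -sqr_matT; apply: groupG_M; apply: groupG_T.
have Si : subst_lin ('i%C%:M : 'M[C]_2) x = 'i%C *: x.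
  by rewrite subst_linx !mxE /= mulr1n mulr0n scale0r addr0.
have := subst_linM ('i%C%:M) (axis_mx R) f.
rewrite (finv _ GS) -scalar_mxC subst_linM fc linearZ /= rmorphXn /= Si exprZn.
move/(scalerI c0); rewrite -[RHS]scale1r => /eqP.
rewrite -subr_eq0 -scalerBl scaler_eq0 expf_eq0 (negPf (X_neq0 _ _)) andbF orbF.
by rewrite subr_eq0 => /eqP.
Qed.

Lemma meval_quartic (c d : C) (p q : Cxy) v :
  (c *: p ^+ 4 + d *: q ^+ 4).@[v] = c * p.@[v] ^+ 4 + d * q.@[v] ^+ 4.
Proof.
have evZ (e : C) (r : Cxy) : (e *: r ^+ 4).@[v] = e * r.@[v] ^+ 4 by rewrite mevalZ rmorphXn.
by rewrite mevalD; exact: congr2 (evZ _ _) (evZ _ _).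
Qed.

(** By D, f = c x^4 + d y^4.  Comparing the values of f(T(x, y)) and f at (1, 0) and
(0, 1) gives c = d = (c + d) k^4 with 4 k^4 = -1, so that 6 c = 0. *)
Lemma invariant_degree4 (f : Cxy) c : Defs.invariant f -> f \is 4.-homog ->
  subst_lin (axis_mx R) f = c *: x ^+ 4 -> c = 0.
Proof.
move=> finv f4 fc.
pose g := f - c *: x ^+ 4.
have gD : subst_lin D g = g.
  by rewrite linearB linearZ /= rmorphXn /= subst_D_x (finv _ (groupG_D R)).
have g0 : subst_lin (axis_mx R) g = 0.
  by rewrite linearB linearZ /= rmorphXn /= subst_axis_x fc subrr.
have g4 : g \is 4.-homog.
  by rewrite rpredB // rpredZ //; apply: homogXn_eq; [apply: homogX|].
have [r Er] := subst_D_dvd_y4 gD g0.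
have y4 : (y ^+ 4 : Cxy) \is 4.-homog by apply: homogXn_eq; [apply: homogX|].
have := pihomogM 4 r y4; rewrite mulrC -Er (pihomog_dE g4) /=.
have [d ->] := dhomog0_const (pihomogP mdeg 0 r) => Eg.
have Ef : f = c *: x ^+ 4 + d *: y ^+ 4.
  by rewrite -[f](subrK (c *: x ^+ 4)) -/g Eg addrC mulrC mul_mpolyC.
have evf v : f.@[v] = c * v ord0 ^+ 4 + d * v ord_max ^+ 4.
  by rewrite {}Ef meval_quartic 2!mevalXU.
have evT v : f.@[fun i => \sum_j T i j * v j] = f.@[v].
  by rewrite -meval_subst (finv _ (groupG_T R)).
pose ev (a b : C) : 'I_2 -> C := fun i => if i == ord0 then a else b.
have := evT (ev 1 0); have := evT (ev 0 1).
have lift0 : lift ord0 ord0 = ord_max :> 'I_2 by exact/val_inj.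
rewrite !evf !big_ord_recl !big_ord0 !matTE !mxE !lift0 /ev /=.
clear -f. have := kappa4 R; move: (kappa R) => k k4 E1 E2.
have /eqP : c * 6%:R = 0.
  have -> : c * 6%:R = 5%:R * (c * 1 ^+ 4 + d * 0 ^+ 4)
    + (c * 0 ^+ 4 + d * 1 ^+ 4) + (c - d) by ring.
  rewrite -E1 -[X in 5%:R * X]E2.
  transitivity (6%:R * (c + d) * k ^+ 4 + c - d); first by ring.
  have -> : 6%:R * (c + d) * k ^+ 4 + c - d =
      (c + d) * (k ^+ 4 * 4%:R) + 2%:R * ((c + d) * k ^+ 4) + c - d by ring.
  have -> : (c + d) * k ^+ 4 = c * 0 ^+ 4 + d * 1 ^+ 4 by rewrite -E1; ring.
  by rewrite k4; ring.
by rewrite mulf_eq0 pnatr_eq0 orbF => /eqP.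
Qed.

Definition lead_poly n : Cxy := lead_form n x y.

Lemma lead_poly_invariant n : Defs.invariant (lead_poly n).
Proof.
rewrite /lead_poly /lead_form -/(face_poly R) -/(edge_poly R); case: ifP => _.
  by apply: invariantXn; apply: face_poly_invariant.
by apply: invariantM; [apply: invariantXn; apply: face_poly_invariant|apply: edge_poly_invariant].
Qed.

Lemma lead_poly_homog n : lead_degree n -> lead_poly n \is n.-homog.
Proof.
move=> nP; rewrite /lead_poly /lead_form -/(face_poly R) -/(edge_poly R); case: ifPn => n8.
  by apply: homogXn_eq; [apply: face_poly_homog|rewrite mulnC divnK].
apply: homogM_eq; [apply: dhomogMn; apply: face_poly_homog|apply: edge_poly_homog|].
by rewrite [RHS](lead_degreeP nP n8) addnC.
Qed.

Lemma subst_lead_poly n (g : 'M[C]_2) u v : subst_lin g x = u -> subst_lin g y = v ->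
  subst_lin g (lead_poly n) = lead_form n u v.
Proof. by move=> <- <-; exact: (@rmorph_lead_form Cxy Cxy (subst_lin g)). Qed.

Lemma lead_poly_axis n : lead_degree n -> subst_lin (axis_mx R) (lead_poly n) = x ^+ n.
Proof.
move=> nP; rewrite (subst_lead_poly n (subst_axis_x R) (subst_axis_y R)).
exact: lead_form_axis.
Qed.

(** The number of s with 24 s <= n such that n - 24 s is a leading degree: every s
up to n / 24 qualifies when 4 divides n, except the last one if it leaves 4. *)
Definition inv_dim n : nat := if (4 %| n)%N then (n %/ 24 + (n %% 24 != 4))%N else 0.

Lemma inv_dim_small n : (n < 24)%N -> inv_dim n = lead_degree n.
Proof. by do 24 (case: n => [//|n]). Qed.

Lemma inv_dimD n : inv_dim (n + 24) = (inv_dim n + (4 %| n))%N.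
Proof.
rewrite /inv_dim dvdn_addl // divnDr // modnDr; case: ifP => _ //.
by rewrite addnAC.
Qed.

Definition inv_basis n s : Cxy := (J ^+ 4) ^+ s * lead_poly (n - 24 * s).

Lemma inv_basis_invariant n s : Defs.invariant (inv_basis n s).
Proof.
apply: invariantM; last exact: lead_poly_invariant.
by apply: invariantXn; apply: vertex_poly4_invariant.
Qed.

Lemma inv_basis_degree n s : (s < inv_dim n)%N ->
  (24 * s <= n)%N /\ lead_degree (n - 24 * s).
Proof.
rewrite /inv_dim /lead_degree; case: ifP => // n4 sn; split; lia.
Qed.

Lemma inv_basis_homog n s : (s < inv_dim n)%N -> inv_basis n s \is n.-homog.
Proof.
move=> /inv_basis_degree[sn ld].
apply: homogM_eq; [apply: dhomogMn; apply: vertex_poly4_homog|exact: lead_poly_homog ld|].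
exact: subnKC.
Qed.

(** Subtract the leading part on the axis, divide the rest by J^4, and go on in degree
n - 24. *)
Lemma inv_span n (f : Cxy) : Defs.invariant f -> f \is n.-homog ->
  exists c : nat -> C, f = \sum_(s < inv_dim n) c s *: inv_basis n s.
Proof.
elim/ltn_ind: n f => n IH f finv fn.
have [c fc] := homog_axis fn.
have c0 : ~~ lead_degree n -> c = 0.
  move=> nP; apply/eqP; apply: contraNT nP => c0.
  rewrite /lead_degree (invariant_axis_degree finv fc c0) /=.
  apply: contra_neq c0 => n4; rewrite n4 in fn fc; exact: invariant_degree4 fc.
pose g := f - c *: lead_poly n.
have cq : c *: lead_poly n \is n.-homog.
  have [/lead_poly_homog/rpredZ -> //|/c0->] := boolP (lead_degree n).
  by rewrite scale0r rpred0.
have gn : g \is n.-homog by rewrite rpredB.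
have ginv : Defs.invariant g.
  by apply: invariantD => //; rewrite -scaleNr; apply/invariantZ/lead_poly_invariant.
have g0 : subst_lin (axis_mx R) g = 0.
  rewrite /g linearB linearZ /= fc; have [/lead_poly_axis ->|/c0->] := boolP (lead_degree n).
    by rewrite subrr.
  by rewrite !scale0r subrr.
have -> : f = c *: lead_poly n + g by rewrite /g addrC subrK.
have := invariant_axis0_quotient ginv gn g0; case: (leqP 24 n) => n24; last first.
  move=> ->; rewrite addr0 (inv_dim_small n24); case: (boolP (lead_degree n)) => [_|/c0 ->].
    by exists (fun=> c); rewrite big_ord1 /inv_basis muln0 subn0 expr0 mul1r.
  by exists (fun=> 0); rewrite big_ord0 scale0r.
move=> [g' [-> g'inv g'n]].
have [|c' ->] := IH (n - 24)%N _ g' g'inv g'n; first by rewrite ltn_subrL (leq_trans _ n24).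
have E : (4 %| n - 24)%N = lead_degree n.
  rewrite /lead_degree dvdn_subl // (_ : n != 4) ?andbT //.
  by rewrite neq_ltn (leq_trans _ n24) ?orbT.
clear fc gn ginv g0 cq; have := inv_dimD (n - 24); rewrite (subnK n24) => ->; rewrite E.
case: (boolP (lead_degree n)) => [nP|nP]; last first.
  exists (fun=> 0); rewrite addn0 /inv_dim E (negPf nP) [RHS]big_ord0 [in LHS]big_ord0.
  by rewrite mulr0 (c0 nP) scale0r addr0.
exists (fun s => if s is s'.+1 then c' s' else c); rewrite addn1 big_ord_recl.
congr (_ + _); first by rewrite /inv_basis muln0 subn0 expr0 mul1r.
rewrite mulr_sumr; apply: eq_bigr => s _; rewrite -scalerAr /inv_basis mulrA -exprS.
by rewrite mulnS subnDA.
Qed.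

(** The substitution kills all terms but the one with s = 0; once its coefficient
is zero, the relation can be divided by p. *)
Lemma adic_free (g : 'M[C]_2) (p : Cxy) N (u : nat -> Cxy) (c : nat -> C) :
  p != 0 -> subst_lin g p = 0 -> (forall s, (s < N)%N -> subst_lin g (u s) != 0) ->
  \sum_(s < N) c s *: (p ^+ s * u s) = 0 -> forall s, (s < N)%N -> c s = 0.
Proof.
move=> p0 gp; elim: N u c => // N IH u c u0.
have -> : \sum_(s < N.+1) c s *: (p ^+ s * u s) =
    c 0%N *: u 0%N + p * \sum_(s < N) c s.+1 *: (p ^+ s * u s.+1).
  rewrite big_ord_recl expr0 mul1r mulr_sumr; congr (_ + _); apply: eq_bigr => s _.
  by rewrite -scalerAr mulrA -exprS.
move=> E; have c0 : c 0%N = 0.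
  have /eqP := congr1 (subst_lin g) E.
  rewrite rmorphD rmorphM /= gp mul0r addr0 rmorph0 linearZ scaler_eq0 /=.
  by rewrite (negPf (u0 0%N isT)) orbF => /eqP.
move: E; rewrite c0 scale0r add0r => /eqP; rewrite mulf_eq0 (negPf p0) /= => /eqP E.
have cS := IH (fun s => u s.+1) (fun s => c s.+1) (fun s sN => u0 s.+1 sN) E.
by case=> [//|s] /cS.
Qed.

Lemma subst_axis_vertex4 : subst_lin (axis_mx R) (J ^+ 4) = 0.
Proof.
rewrite subst_linXn (subst_vertex_poly (subst_axis_x R) (subst_axis_y R)).
by rewrite /vertex_form !(mulr0, expr0n) addr0 expr0n.
Qed.

Lemma inv_free n (c : nat -> C) : \sum_(s < inv_dim n) c s *: inv_basis n s = 0 ->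
  forall s, (s < inv_dim n)%N -> c s = 0.
Proof.
move=> E; apply: (adic_free (u := fun s => lead_poly (n - 24 * s))
  (vertex_poly4_neq0 R) subst_axis_vertex4 _ E).
move=> s /inv_basis_degree[_ ld].
by rewrite lead_poly_axis // expf_neq0 // X_neq0.
Qed.

End InvariantBasis.

(** * Dimensions of the graded pieces *)

Section GradedDimensions.
Variable R : realType.
Local Notation C := R[i].
Local Notation Cxy := {mpoly C[2]}.
Local Opaque subst_lin kappa.

Lemma graded_dim_basis m (rho : 'M[C]_2 -> 'M[C]_m) k (I : finType)
    (E : I -> 'cV[Cxy]_m) :
  (forall i r, E i r ord0 \is k.-homog) ->
  (forall c : I -> C, vvinv rho (\sum_i (c i)%:MP *: E i)) ->
  (forall F, vvinv rho F -> (forall r, F r ord0 \is k.-homog) ->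
     exists c : I -> C, F = \sum_i (c i)%:MP *: E i) ->
  (forall c : I -> C, \sum_i (c i)%:MP *: E i = 0 -> forall i, c i = 0) ->
  graded_dim rho k #|I|.
Proof.
move=> homE invE spanE freeE.
pose v i : {ffun 'I_m -> dhomog 2 C k} := [ffun r => DHomog (homE i r)].
pose ev (j : 'I_#|I|) : I := enum_val j.
pose X := [tuple v (ev j) | j < #|I|].
have XE (j : 'I_#|I|) : X`_j = v (ev j) by rewrite -tnth_nth tnth_mktuple.
pose col (F : {ffun 'I_m -> dhomog 2 C k}) : 'cV[Cxy]_m := \col_r (F r : Cxy).
have colX (c : I -> C) : col (\sum_j c (ev j) *: X`_j) = \sum_i (c i)%:MP *: E i.
  rewrite [RHS](reindex ev) /=; last first.
    by apply: onW_bij; exact: enum_val_bij.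
  apply/matrixP=> r z; rewrite (ord1 z) mxE sum_ffunE summxE.
  rewrite (linear_sum (@mpoly_of_dhomog 2 C k)). apply: eq_bigr => j _.
  rewrite XE !ffunE linearZ /= mxE.
  by rewrite mul_mpolyC.
have colX' (c : 'I_#|I| -> C) : col (\sum_j c j *: X`_j) = \sum_i (c (enum_rank i))%:MP *: E i.
  rewrite -colX; congr col; apply: eq_bigr => j _; by rewrite /ev enum_valK.
have col_inj : injective col.
  move=> F G /matrixP FG; apply/ffunP => r; apply/val_inj.
  by have := FG r ord0; rewrite !mxE.
exists <<X>>%VS; last first.
  have /eqP : free X.
    apply/freeP => c c0 j.
    have := colX' c; rewrite c0.
    have -> : col 0 = 0 by apply/matrixP=> r z; rewrite !mxE ffunE.
    by move/esym/freeE/(_ (ev j)); rewrite /ev enum_valK.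
  by rewrite size_tuple.
move=> F; split=> [/coord_span FE|Finv].
  by rewrite -/(col F) FE colX'.
have [c Fc] : exists c : I -> C, col F = \sum_i (c i)%:MP *: E i.
  apply: spanE => [//|r]; rewrite mxE; exact: dhomog_is_dhomog.
have -> : F = \sum_j c (ev j) *: X`_j by apply: col_inj; rewrite colX.
apply: rpred_sum => j _; apply/rpredZ/memv_span.
by rewrite mem_nth // size_tuple.
Qed.

(** The contribution to degree k of a generator of degree d. *)
Definition inv_dim_from d k : nat := if (d <= k)%N then inv_dim (k - d) else 0.

Lemma inv_dim_fromP d k s : (s < inv_dim_from d k)%N -> (d <= k)%N /\ (s < inv_dim (k - d))%N.
Proof. by rewrite /inv_dim_from; case: ifP. Qed.

(** Products of a generator b_j with the basis of the invariants of degree k - d_j.  A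
homogeneous F is first written with arbitrary invariant coefficients, which are
then replaced by their homogeneous components of degree k - d_j. *)
Lemma graded_dim_free m (rho : 'M[C]_2 -> 'M[C]_m) (b : m.-tuple 'cV[Cxy]_m)
    (d : 'I_m -> nat) k :
  free_basis rho b -> (forall j r, tnth b j r ord0 \is (d j).-homog) ->
  graded_dim rho k (\sum_j inv_dim_from (d j) k).
Proof.
move=> [bP bspan bfree] bd.
pose I := {j : 'I_m & 'I_(inv_dim_from (d j) k)}.
have -> : (\sum_j inv_dim_from (d j) k)%N = #|{: I}|.
  by rewrite card_tagged sumnE big_map big_enum /=; apply: eq_bigr => j _; rewrite card_ord.
pose beta (p : I) : Cxy := inv_basis R (k - d (tag p)) (tagged p).
pose E (p : I) : 'cV[Cxy]_m := beta p *: tnth b (tag p).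
pose a (c : I -> C) j : Cxy := \sum_(s < inv_dim_from (d j) k)
  c (Tagged (fun j => 'I_(inv_dim_from (d j) k)) s) *: inv_basis R (k - d j) s.
have sumE c : \sum_p (c p)%:MP *: E p = \sum_j a c j *: tnth b j.
  transitivity (\sum_j \sum_(s < inv_dim_from (d j) k)
    (c (Tagged (fun j => 'I_(inv_dim_from (d j) k)) s) *: inv_basis R (k - d j) s) *: tnth b j).
    rewrite sig_big_dep /=; apply: eq_bigr => -[j s] _ /=.
    by rewrite /E /beta /= scalerA mul_mpolyC.
  by apply: eq_bigr => j _; rewrite scaler_suml.
have aP c j : Defs.invariant (a c j).
  move=> g Gg; rewrite /a linear_sum; apply: eq_bigr => s _; rewrite linearZ /=.
  by rewrite (inv_basis_invariant _ _ Gg).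
apply: (@graded_dim_basis _ _ _ _ E).
- move=> [j s] r; rewrite /E mxE /beta /=.
  have [dk sk] := inv_dim_fromP (ltn_ord s).
  apply: homogM_eq; [exact: inv_basis_homog sk|exact: bd|exact: subnK].
- by move=> c; rewrite sumE; apply: vvinv_comb.
- move=> F /bspan[f finv {F}->] Fk.
  pose f' j : Cxy := if (d j <= k)%N then pihomog mdeg (k - d j) (f j) else 0.
  have -> : \sum_j f j *: tnth b j = \sum_j f' j *: tnth b j.
    apply/matrixP=> r z; rewrite (ord1 z) [RHS]summxE.
    rewrite -[LHS](pihomog_dE (Fk r)) [in LHS]summxE.
    rewrite (linear_sum (pihomog mdeg k)); apply: eq_bigr => j _.
    rewrite [in LHS]mxE [RHS]mxE [in LHS]mulrC. rewrite [LHS](pihomogM k (f j) (bd j r)) /f'.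
    by case: ifP => _; rewrite ?mul0r // mulrC.
  have /choice[c cP] : forall j, exists c : nat -> C,
      f' j = \sum_(s < inv_dim_from (d j) k) c s *: inv_basis R (k - d j) s.
    move=> j; rewrite /f' /inv_dim_from; case: ifP => _; last by exists (fun=> 0); rewrite big_ord0.
    by apply: inv_span; [apply: pihomog_invariant|apply: pihomogP].
  exists (fun p : I => c (tag p) (tagged p : nat)); rewrite sumE.
  by apply: eq_bigr => j _; rewrite cP.
- move=> c; rewrite sumE => /(bfree _ (aP c)) a0 [j s].
  have [dk sk] := inv_dim_fromP (ltn_ord s).
  (* [inv_free] takes coefficients indexed by natural numbers *)
  pose c' (t : nat) : C := oapp (fun u : 'I_(inv_dim_from (d j) k) =>
    c (@Tagged _ j (fun j => 'I_(inv_dim_from (d j) k)) u)) 0 (insub t).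
  have := a0 j; rewrite /a => aj.
  have : c' s = 0; last by rewrite /c' valK.
  apply: (inv_free _ sk); rewrite -[RHS]aj.
  have -> : inv_dim (k - d j) = inv_dim_from (d j) k by rewrite /inv_dim_from dk.
  by apply: eq_bigr => t _; rewrite /c' valK.
Qed.

Lemma inv_dim4 u : inv_dim (4 * u) = (u %/ 6 + (u %% 6 != 1))%N.
Proof. by rewrite /inv_dim dvdn_mulr // (_ : 24 = 4 * 6)%N // divnMl // -muln_modr //; lia. Qed.

(** The product (1 - t^8)(1 - t^12) times the series of [inv_dim] is 1, in a form free of
subtraction. *)
Lemma inv_dim_rec m :
  (inv_dim m + (if 20 <= m then inv_dim (m - 20) else 0) =
   (m == 0) + (if 8 <= m then inv_dim (m - 8) else 0)
   + (if 12 <= m then inv_dim (m - 12) else 0))%N.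
Proof.
have [m24|] := ltnP m 24; first by do 24 (case: m m24 => [//|m] m24).
move=> /subnK <-; move: (m - 24)%N => {}m.
rewrite addn_eq0 andbF add0n !(leq_trans _ (leq_addl m 24)) //.
have -> : (m + 24 - 20 = m + 4)%N by lia.
have -> : (m + 24 - 8 = m + 16)%N by lia.
have -> : (m + 24 - 12 = m + 12)%N by lia.
case: (boolP (4 %| m)%N) => [/dvdnP[u ->]|m4]; last first.
  by rewrite /inv_dim !dvdn_addl // (negPf m4).
have -> : (u * 4 + 24 = 4 * (u + 6))%N by lia.
have -> : (u * 4 + 4 = 4 * (u + 1))%N by lia.
have -> : (u * 4 + 16 = 4 * (u + 4))%N by lia.
have -> : (u * 4 + 12 = 4 * (u + 3))%N by lia.
by rewrite !inv_dim4; lia.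
Qed.

End GradedDimensions.

(** * Hilbert series *)

Local Notation molien_den := ((1 - 'X^8) * (1 - 'X^12) : {poly int}).

Lemma coef_molien_den j : molien_den`_j =
  (j == 0%N)%:R - (j == 8)%:R - (j == 12)%:R + (j == 20)%:R.
Proof.
have -> : molien_den = 1 - 'X^8 - 'X^12 + 'X^20.
  by rewrite -['X^20]/('X^(8 + 12)) exprD; ring.
by rewrite !(coefD, coefN, coefXn, coef1).
Qed.

Lemma sum_delta_sub (a n : nat) (F : nat -> int) :
  \sum_(j < n.+1) (j == a :> nat)%:R * F (n - j)%N = if (a <= n)%N then F (n - a)%N else 0.
Proof.
case: leqP => an; last first.
  rewrite big1 // => j _; rewrite (_ : _ == _ = false) ?mul0r //.
  by apply/eqP => ja; have := ltn_ord j; rewrite ja ltnS leqNgt an.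
rewrite (bigD1 (Ordinal (an : a < n.+1)%N)) //= eqxx mul1r big1 ?addr0 // => j.
by rewrite -val_eqE /= => /negPf->; rewrite mul0r.
Qed.

Lemma molien_conv d n :
  \sum_(j < n.+1) molien_den`_j * (inv_dim_from d (n - j))%:Z = (n == d)%:R.
Proof.
under eq_bigr do rewrite coef_molien_den !(mulrDl, mulNr).
rewrite !big_split /= !sumrN !(sum_delta_sub _ _ (fun k => (inv_dim_from d k)%:Z)).
rewrite leq0n subn0.
have [nd|dn] := ltnP n d.
  rewrite (_ : n == d = false); last by apply/eqP; lia.
  have z k : inv_dim_from d (n - k) = 0%N.
    by rewrite /inv_dim_from leqNgt (leq_ltn_trans (leq_subr k n) nd).
  by have := z 0%N; rewrite subn0 => ->; rewrite !z !if_same.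
move/subnK: dn <-; move: (n - d)%N => m.
have shift a : (if (a <= m + d)%N then (inv_dim_from d (m + d - a))%:Z else 0) =
    (if (a <= m)%N then inv_dim (m - a) else 0%N)%:Z.
  rewrite /inv_dim_from; case: (leqP a m) => am.
    have -> : (a <= m + d)%N by lia.
    have -> : (d <= m + d - a)%N by lia.
    by congr (inv_dim _)%:Z; lia.
  case: ifP => // amd; have -> // : (d <= m + d - a)%N = false by lia.
have := shift 0%N; rewrite !subn0 !leq0n => ->; rewrite !shift.
have -> : (m + d == d)%N = (m == 0%N) by lia.
move: (inv_dim_rec m); move: (inv_dim m) (if (20 <= m)%N then _ else _).
move: (if (8 <= m)%N then _ else _) (if (12 <= m)%N then _ else _) => h8 h12 h0 h20.
by case: (m == 0%N) => E; lia.
Qed.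

Lemma dimension_formula_free (R : realType) m (rho : 'M[R[i]]_2 -> 'M[R[i]]_m)
    (d : 'I_m -> nat) (e : {poly int}) :
  (forall k, graded_dim rho k (\sum_j inv_dim_from (d j) k)) ->
  (forall k, (k < size e)%N -> (\sum_j inv_dim_from (d j) k)%:Z = e`_k) ->
  dimension_formula rho (\sum_j 'X^(d j)) molien_den e.
Proof.
move=> gd ed; exists (fun k => \sum_j inv_dim_from (d j) k)%N; split=> // n.
rewrite coef_sum; under [RHS]eq_bigr do rewrite coefXn -molien_conv.
rewrite exchange_big /=; apply: eq_bigr => j _.
by rewrite -mulr_sumr (big_morph Posz PoszD (erefl _)).
Qed.

(** * Identities for the generators *)

Section SmallDeterminants.
Variable A : comNzRingType.

Lemma det_mxrows1 (a : A) : \det (mxrows [tuple [tuple a]]) = a.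
Proof. by rewrite det_mx11 mxE !(tnth_nth 0) /=. Qed.

Lemma det_mxrows2 (a b c d : A) :
  \det (mxrows [tuple [tuple a; b]; [tuple c; d]]) = a * d - b * c.
Proof.
rewrite (expand_det_row _ ord0) !big_ord_recl big_ord0 /cofactor !det_mx11 !mxE.
by rewrite !(tnth_nth 0) /=; ring.
Qed.

Lemma det_minor n (t : n.-tuple (n.-tuple A)) (M : 'M[A]_n.+1) j :
  (forall i k, M (lift ord0 i) (lift j k) = tnth (tnth t i) k) ->
  \det (row' ord0 (col' j M)) = \det (mxrows t).
Proof. by move=> Et; congr (\det _); apply/matrixP=> i k; rewrite !mxE Et. Qed.

Lemma det_mxrows3 (a1 a2 a3 b1 b2 b3 c1 c2 c3 : A) :
  \det (mxrows [tuple [tuple a1; a2; a3]; [tuple b1; b2; b3]; [tuple c1; c2; c3]]) =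
  a1 * (b2 * c3 - b3 * c2) - a2 * (b1 * c3 - b3 * c1) + a3 * (b1 * c2 - b2 * c1).
Proof.
rewrite (expand_det_row _ ord0) !big_ord_recl big_ord0 /cofactor.
rewrite (det_minor (t := [tuple [tuple b2; b3]; [tuple c2; c3]])); last first.
  by move=> [[|[|//]] ?] [[|[|//]] ?]; rewrite mxE !(tnth_nth 0) /=.
rewrite (det_minor (t := [tuple [tuple b1; b3]; [tuple c1; c3]])); last first.
  by move=> [[|[|//]] ?] [[|[|//]] ?]; rewrite mxE !(tnth_nth 0) /=.
rewrite (det_minor (t := [tuple [tuple b1; b2]; [tuple c1; c2]])); last first.
  by move=> [[|[|//]] ?] [[|[|//]] ?]; rewrite mxE !(tnth_nth 0) /=.
by rewrite !det_mxrows2 !mxE !(tnth_nth 0) /=; ring.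
Qed.

Lemma det_mxrows4 (a1 a2 a3 a4 b1 b2 b3 b4 c1 c2 c3 c4 d1 d2 d3 d4 : A) :
  let m3 x1 x2 x3 y1 y2 y3 z1 z2 z3 :=
    x1 * (y2 * z3 - y3 * z2) - x2 * (y1 * z3 - y3 * z1) + x3 * (y1 * z2 - y2 * z1) in
  \det (mxrows [tuple [tuple a1; a2; a3; a4]; [tuple b1; b2; b3; b4];
                      [tuple c1; c2; c3; c4]; [tuple d1; d2; d3; d4]]) =
  a1 * m3 b2 b3 b4 c2 c3 c4 d2 d3 d4 - a2 * m3 b1 b3 b4 c1 c3 c4 d1 d3 d4
  + a3 * m3 b1 b2 b4 c1 c2 c4 d1 d2 d4 - a4 * m3 b1 b2 b3 c1 c2 c3 d1 d2 d3.
Proof.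
move=> m3; rewrite (expand_det_row _ ord0) !big_ord_recl big_ord0 /cofactor.
rewrite (det_minor
  (t := [tuple [tuple b2; b3; b4]; [tuple c2; c3; c4]; [tuple d2; d3; d4]])); last first.
  by move=> [[|[|[|//]]] ?] [[|[|[|//]]] ?]; rewrite mxE !(tnth_nth 0) /=.
rewrite (det_minor
  (t := [tuple [tuple b1; b3; b4]; [tuple c1; c3; c4]; [tuple d1; d3; d4]])); last first.
  by move=> [[|[|[|//]]] ?] [[|[|[|//]]] ?]; rewrite mxE !(tnth_nth 0) /=.
rewrite (det_minor
  (t := [tuple [tuple b1; b2; b4]; [tuple c1; c2; c4]; [tuple d1; d2; d4]])); last first.
  by move=> [[|[|[|//]]] ?] [[|[|[|//]]] ?]; rewrite mxE !(tnth_nth 0) /=.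
rewrite (det_minor
  (t := [tuple [tuple b1; b2; b3]; [tuple c1; c2; c3]; [tuple d1; d2; d3]])); last first.
  by move=> [[|[|[|//]]] ?] [[|[|[|//]]] ?]; rewrite mxE !(tnth_nth 0) /=.
by rewrite !det_mxrows3 !mxE !(tnth_nth 0) /m3 /=; ring.
Qed.

End SmallDeterminants.

Section Generators.
Variable A : comNzRingType.
Implicit Types x y k : A.

(** Each entry of [genN] is one generator of the module M(rho_N), as a list of
components, so that [mxrows] of it is the transpose of the matrix B. *)
Definition gen3 x y : 1.-tuple (1.-tuple A) := [tuple [tuple - x ^+ 5 * y + x * y ^+ 5]].

Definition gen5 x y : 2.-tuple (2.-tuple A) :=
  [tuple [tuple x ^+ 4 + y ^+ 4; 6%:R * x ^+ 2 * y ^+ 2];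
         [tuple - x ^+ 8 + 10%:R * x ^+ 4 * y ^+ 4 - y ^+ 8;
                12%:R * x ^+ 6 * y ^+ 2 + 12%:R * x ^+ 2 * y ^+ 6]].

Definition gen10 x y : 2.-tuple (2.-tuple A) :=
  [tuple [tuple x; y]; [tuple - x ^+ 5 + 5%:R * x * y ^+ 4; 5%:R * x ^+ 4 * y - y ^+ 5]].

Definition gen13 x y : 3.-tuple (3.-tuple A) :=
  [tuple [tuple x ^+ 2; x * y; y ^+ 2];
         [tuple - x ^+ 6 + 5%:R * x ^+ 2 * y ^+ 4;
                2%:R * x ^+ 5 * y + 2%:R * x * y ^+ 5;
                5%:R * x ^+ 4 * y ^+ 2 - y ^+ 6];
         [tuple - x ^+ 2 * (x ^+ 4 - 5%:R * y ^+ 4) ^+ 2;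
                x * y * (5%:R * x ^+ 4 - y ^+ 4) * (x ^+ 4 - 5%:R * y ^+ 4);
                - y ^+ 2 * (5%:R * x ^+ 4 - y ^+ 4) ^+ 2]].

Definition gen15 x y : 4.-tuple (4.-tuple A) :=
  [tuple [tuple x ^+ 3; x ^+ 2 * y; x * y ^+ 2; y ^+ 3];
         [tuple - x ^+ 7 + 5%:R * x ^+ 3 * y ^+ 4;
                x ^+ 6 * y + 3%:R * x ^+ 2 * y ^+ 5;
                3%:R * x ^+ 5 * y ^+ 2 + x * y ^+ 6;
                5%:R * x ^+ 4 * y ^+ 3 - y ^+ 7];
         [tuple - 6%:R * x ^+ 7 * y ^+ 4 + 6%:R * x ^+ 3 * y ^+ 8;
                - x ^+ 10 * y + x ^+ 2 * y ^+ 9;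
                x ^+ 9 * y ^+ 2 - x * y ^+ 10;
                6%:R * x ^+ 8 * y ^+ 3 - 6%:R * x ^+ 4 * y ^+ 7];
         [tuple - 24%:R * x ^+ 11 * y ^+ 4 + 24%:R * x ^+ 7 * y ^+ 8;
                x ^+ 14 * y - 7%:R * x ^+ 10 * y ^+ 5
                  + 3%:R * x ^+ 6 * y ^+ 9 + 3%:R * x ^+ 2 * y ^+ 13;
                3%:R * x ^+ 13 * y ^+ 2 + 3%:R * x ^+ 9 * y ^+ 6
                  - 7%:R * x ^+ 5 * y ^+ 10 + x * y ^+ 14;
                24%:R * x ^+ 8 * y ^+ 7 - 24%:R * x ^+ 4 * y ^+ 11]].

Lemma det_gen5 x y : \det (mxrows (gen5 x y)) = 18%:R * vertex_form x y ^+ 2.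
Proof. by rewrite det_mxrows2 /vertex_form; ring. Qed.

Lemma det_gen10 x y : \det (mxrows (gen10 x y)) = - 6%:R * vertex_form x y.
Proof. by rewrite det_mxrows2 /vertex_form; ring. Qed.

Lemma det_gen13 x y : \det (mxrows (gen13 x y)) = 108%:R * vertex_form x y ^+ 3.
Proof. by rewrite det_mxrows3 /vertex_form; ring. Qed.

Lemma det_gen15 x y : \det (mxrows (gen15 x y)) = - 36%:R * vertex_form x y ^+ 6.
Proof. by rewrite det_mxrows4 /vertex_form; ring. Qed.

(** The matrices rho(T) as functions of the scalar k of T, so that the action of T on
the generators becomes an identity over any ring containing such a k. *)
Definition rho3T_mx k : 'M[A]_1 := (k ^+ 2) *: mxrows [tuple [tuple - 2%:R]].
Definition rho5T_mx k : 'M[A]_2 := (2%:R * k ^+ 4) *: mxrows [tuple [tuple 1; 1]; [tuple 3%:R; -1]].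
Definition rho10T_mx k : 'M[A]_2 := k *: mxrows [tuple [tuple 1; 1]; [tuple 1; -1]].
Definition rho13T_mx k : 'M[A]_3 := k ^+ 2 *: mxrows
  [tuple [tuple 1; 2%:R; 1]; [tuple 1; 0; -1]; [tuple 1; - 2%:R; 1]].
Definition rho15T_mx k : 'M[A]_4 := k ^+ 3 *: mxrows
  [tuple [tuple 1; 3%:R; 3%:R; 1]; [tuple 1; 1; -1; -1];
         [tuple 1; -1; -1; 1]; [tuple 1; - 3%:R; 3%:R; -1]].

(** On a generator of degree d + 4a the substitution T brings out the factor
k^(d + 4a), whereas rho(T) contains only k^d: the two sides differ by a power of
-4 k^4 = 1. *)
Lemma eq_scale_kappa4 k u v a : k ^+ 4 * 4%:R = -1 -> u = (- (k ^+ 4 * 4%:R)) ^+ a * v -> u = v.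
Proof. by move=> -> ->; rewrite opprK expr1n mul1r. Qed.

Ltac entries := rewrite !mxE !big_ord_recl big_ord0 !mxE !(tnth_nth 0) /=.

Lemma gen3_T k x y : k ^+ 4 * 4%:R = -1 ->
  (mxrows (gen3 (k * (x + y)) (k * (x - y))))^T = rho3T_mx k *m (mxrows (gen3 x y))^T.
Proof.
move=> k4; apply/matrixP=> i j; apply: (@eq_scale_kappa4 k _ _ 1 k4); clear k4; move: i j.
by move=> [[|//] ?] [[|//] ?]; entries; ring.
Qed.

Lemma gen5_T k x y : k ^+ 4 * 4%:R = -1 ->
  (mxrows (gen5 (k * (x + y)) (k * (x - y))))^T = rho5T_mx k *m (mxrows (gen5 x y))^T.
Proof.
move=> k4; apply/matrixP=> i j; apply: (@eq_scale_kappa4 k _ _ j k4); clear k4; move: i j.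
by move=> [[|[|//]] ?] [[|[|//]] ?]; entries; ring.
Qed.

Lemma gen10_T k x y : k ^+ 4 * 4%:R = -1 ->
  (mxrows (gen10 (k * (x + y)) (k * (x - y))))^T = rho10T_mx k *m (mxrows (gen10 x y))^T.
Proof.
move=> k4; apply/matrixP=> i j; apply: (@eq_scale_kappa4 k _ _ j k4); clear k4; move: i j.
by move=> [[|[|//]] ?] [[|[|//]] ?]; entries; ring.
Qed.

Lemma gen13_T k x y : k ^+ 4 * 4%:R = -1 ->
  (mxrows (gen13 (k * (x + y)) (k * (x - y))))^T = rho13T_mx k *m (mxrows (gen13 x y))^T.
Proof.
move=> k4; apply/matrixP=> i j; apply: (@eq_scale_kappa4 k _ _ j k4); clear k4; move: i j.
by move=> [[|[|[|//]]] ?] [[|[|[|//]]] ?]; entries; ring.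
Qed.

Lemma gen15_T k x y : k ^+ 4 * 4%:R = -1 ->
  (mxrows (gen15 (k * (x + y)) (k * (x - y))))^T = rho15T_mx k *m (mxrows (gen15 x y))^T.
Proof.
move=> k4; apply/matrixP=> i j; apply: (@eq_scale_kappa4 k _ _ j k4); clear k4; move: i j.
by move=> [[|[|[|[|//]]]] ?] [[|[|[|[|//]]]] ?]; entries; ring.
Qed.

Lemma expr_mod4 k n : k ^+ 4 = 1 -> k ^+ n = k ^+ (n %% 4).
Proof. by move=> k4; rewrite {1}(divn_eq n 4) exprD mulnC exprM k4 expr1n mul1r. Qed.

Ltac weights k4 :=
  rewrite !(tnth_nth 0) /= ?exprMn ?(expr_mod4 14 k4) ?(expr_mod4 13 k4) ?(expr_mod4 12 k4)
    ?(expr_mod4 11 k4) ?(expr_mod4 10 k4) ?(expr_mod4 9 k4) ?(expr_mod4 8 k4)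
    ?(expr_mod4 7 k4) ?(expr_mod4 6 k4) ?(expr_mod4 5 k4) ?k4; ring.

Lemma gen3_D k x y i j : k ^+ 4 = 1 ->
  tnth (tnth (gen3 x (k * y)) j) i = k * tnth (tnth (gen3 x y) j) i.
Proof. by move=> k4; case: i j => [[|//] ?] [[|//] ?]; weights k4. Qed.

Lemma gen5_D k x y i j : k ^+ 4 = 1 ->
  tnth (tnth (gen5 x (k * y)) j) i = k ^+ (2 * i) * tnth (tnth (gen5 x y) j) i.
Proof. by move=> k4; case: i j => [[|[|//]] ?] [[|[|//]] ?]; weights k4. Qed.

Lemma gen10_D k x y i j : k ^+ 4 = 1 ->
  tnth (tnth (gen10 x (k * y)) j) i = k ^+ i * tnth (tnth (gen10 x y) j) i.
Proof. by move=> k4; case: i j => [[|[|//]] ?] [[|[|//]] ?]; weights k4. Qed.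

Lemma gen13_D k x y i j : k ^+ 4 = 1 ->
  tnth (tnth (gen13 x (k * y)) j) i = k ^+ i * tnth (tnth (gen13 x y) j) i.
Proof. by move=> k4; case: i j => [[|[|[|//]]] ?] [[|[|[|//]]] ?]; weights k4. Qed.

Lemma gen15_D k x y i j : k ^+ 4 = 1 ->
  tnth (tnth (gen15 x (k * y)) j) i = k ^+ i * tnth (tnth (gen15 x y) j) i.
Proof. by move=> k4; case: i j => [[|[|[|[|//]]]] ?] [[|[|[|[|//]]]] ?]; weights k4. Qed.

End Generators.

Section GeneratorMorph.
Variables (A B : comNzRingType) (f : {rmorphism A -> B}).
Implicit Types x y k : A.

Ltac push_morph :=
  rewrite !(tnth_nth 0) /= ?(rmorph_nat, rmorphXn, rmorphN, rmorphB, rmorphD, rmorphM).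

Lemma rmorph_gen3 x y i j :
  f (tnth (tnth (gen3 x y) j) i) = tnth (tnth (gen3 (f x) (f y)) j) i.
Proof. by case: i j => [[|//] ?] [[|//] ?]; push_morph. Qed.

Lemma rmorph_gen5 x y i j :
  f (tnth (tnth (gen5 x y) j) i) = tnth (tnth (gen5 (f x) (f y)) j) i.
Proof. by case: i j => [[|[|//]] ?] [[|[|//]] ?]; push_morph. Qed.

Lemma rmorph_gen10 x y i j :
  f (tnth (tnth (gen10 x y) j) i) = tnth (tnth (gen10 (f x) (f y)) j) i.
Proof. by case: i j => [[|[|//]] ?] [[|[|//]] ?]; push_morph. Qed.

Lemma rmorph_gen13 x y i j :
  f (tnth (tnth (gen13 x y) j) i) = tnth (tnth (gen13 (f x) (f y)) j) i.
Proof. by case: i j => [[|[|[|//]]] ?] [[|[|[|//]]] ?]; push_morph. Qed.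

Lemma rmorph_gen15 x y i j :
  f (tnth (tnth (gen15 x y) j) i) = tnth (tnth (gen15 (f x) (f y)) j) i.
Proof. by case: i j => [[|[|[|[|//]]]] ?] [[|[|[|[|//]]]] ?]; push_morph. Qed.

Lemma rmorph_rho3T k : map_mx f (rho3T_mx k) = rho3T_mx (f k).
Proof.
by apply/matrixP => -[[|//] ?] [[|//] ?]; rewrite !mxE; push_morph.
Qed.

Lemma rmorph_rho5T k : map_mx f (rho5T_mx k) = rho5T_mx (f k).
Proof.
by apply/matrixP => -[[|[|//]] ?] [[|[|//]] ?]; rewrite !mxE;
  push_morph; rewrite ?rmorph1.
Qed.

Lemma rmorph_rho10T k : map_mx f (rho10T_mx k) = rho10T_mx (f k).
Proof.
by apply/matrixP => -[[|[|//]] ?] [[|[|//]] ?]; rewrite !mxE;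
  push_morph; rewrite ?rmorph1.
Qed.

Lemma rmorph_rho13T k : map_mx f (rho13T_mx k) = rho13T_mx (f k).
Proof.
by apply/matrixP => -[[|[|[|//]]] ?] [[|[|[|//]]] ?]; rewrite !mxE;
  push_morph; rewrite ?(rmorph0, rmorph1).
Qed.

Lemma rmorph_rho15T k : map_mx f (rho15T_mx k) = rho15T_mx (f k).
Proof.
by apply/matrixP => -[[|[|[|[|//]]]] ?] [[|[|[|[|//]]]] ?]; rewrite !mxE;
  push_morph; rewrite ?(rmorph0, rmorph1).
Qed.

End GeneratorMorph.

(** * From identities to free modules *)

Section Criterion.
Variable R : realType.
Local Notation C := R[i].
Local Notation Cxy := {mpoly C[2]}.
Local Notation x := ('X_ord0 : Cxy).
Local Notation y := ('X_ord_max : Cxy).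
Local Notation T := (matT R).
Local Notation D := (matD R).
Local Notation lift := (map_mx (fun c : C => c%:MP_[2])).
Local Opaque subst_lin kappa.

(** The identities are needed with k in the field, to identify rho(T), and with k in the
polynomial ring, to compute the substitution; hence generators and matrices are
families over all commutative rings. *)
Theorem free_module_criterion m
    (gen : forall A : comNzRingType, A -> A -> m.-tuple (m.-tuple A))
    (N : forall A : comNzRingType, A -> 'M[A]_m)
    (AT AD : 'M[C]_m) (e d : 'I_m -> nat) (c : C) (num series : {poly int}) :
  (forall (A B : comNzRingType) (f : {rmorphism A -> B}) u v i j,
     f (tnth (tnth (gen A u v) j) i) = tnth (tnth (gen B (f u) (f v)) j) i) ->
  (forall (A B : comNzRingType) (f : {rmorphism A -> B}) k, map_mx f (N A k) = N B (f k)) ->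
  (forall (A : comNzRingType) (k u v : A), k ^+ 4 * 4%:R = -1 ->
     (mxrows (gen A (k * (u + v)) (k * (u - v))))^T = N A k *m (mxrows (gen A u v))^T) ->
  (forall (A : comNzRingType) (k u v : A) i j, k ^+ 4 = 1 ->
     tnth (tnth (gen A u (k * v)) j) i = k ^+ e i * tnth (tnth (gen A u v) j) i) ->
  AT = N C (kappa R) -> AD = diag_mx (\row_r 'i%C ^+ e r) -> (forall r, e r < 4)%N ->
  \det (mxrows (gen Cxy x y)) = c *: vertex_poly R ^+ (\sum_r e r) -> c != 0 ->
  (forall i j, tnth (tnth (gen Cxy x y) j) i \is (d j).-homog) ->
  num = \sum_j 'X^(d j) ->
  (forall k, (k < size series)%N -> (\sum_j inv_dim_from (d j) k)%:Z = series`_k) ->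
  (exists rho, representation_with_values AT AD rho) /\
  (forall rho, representation_with_values AT AD rho ->
     free_basis rho [tuple colv (tnth (gen Cxy x y) j) | j < m] /\
     dimension_formula rho num ((1 - 'X^8) * (1 - 'X^12)) series).
Proof.
move=> gen_morph N_morph gen_T gen_D ATE ADE e4 det_gen c0 homog_gen numE seriesE.
set b := [tuple _ | _ < _].
have gensE : gens_mx b = (mxrows (gen Cxy x y))^T.
  by apply/matrixP=> i j; rewrite [LHS]mxE tnth_mktuple [LHS]mxE [RHS]mxE [RHS]mxE.
have gens_subst g u v : subst_lin g x = u -> subst_lin g y = v ->
    map_mx (subst_lin g) (gens_mx b) = (mxrows (gen Cxy u v))^T.
  move=> <- <-; rewrite gensE; apply/matrixP=> i j.
  rewrite [LHS]mxE [in LHS]mxE [in LHS]mxE [RHS]mxE [RHS]mxE.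
  exact: (gen_morph Cxy Cxy (subst_lin g)).
have gensT : map_mx (subst_lin T) (gens_mx b) = lift AT *m gens_mx b.
  rewrite (gens_subst _ _ _ (subst_T_xM R) (subst_T_yM R)) (gen_T _ _ _ _ (kappaMP4 R)).
  by rewrite -gensE ATE; congr (_ *m _); rewrite -(N_morph C Cxy (@mpolyC 2 C)).
have gensD : map_mx (subst_lin D) (gens_mx b) = lift AD *m gens_mx b.
  rewrite (gens_subst _ _ _ (subst_D_x R) (subst_D_yM R)) ADE map_diag_mx mul_diag_mx gensE.
  apply/matrixP=> i j; rewrite [LHS]mxE [LHS]mxE (gen_D _ _ _ _ _ _ (expi4MP R)).
  rewrite [RHS]mxE; congr (_ * _); last by rewrite [RHS]mxE [RHS]mxE.
  by rewrite [RHS]mxE mxE rmorphXn.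
have detb : \det (gens_mx b) = c *: vertex_poly R ^+ (\sum_r e r) by rewrite gensE det_tr.
have homogb j r : tnth b j r ord0 \is (d j).-homog by rewrite tnth_mktuple mxE.
move: b gensT gensD detb homogb {gensE gens_subst det_gen} => b gensT gensD detb homogb.
split.
  apply: exists_representation gensT gensD.
  by rewrite {}detb scaler_eq0 negb_or c0 expf_neq0 // vertex_poly_neq0.
move=> rho rhoP; have [rho_rep rhoT rhoD] := rhoP.
have bP j : vvinv rho (tnth b j).
  exact: vvinv_of_TD rhoP ((subst_gens_mx b T _).1 gensT j) ((subst_gens_mx b D _).1 gensD j).
have free : free_basis rho b.
  apply: (free_basis_criterion rho_rep _ e4 bP c0 detb); rewrite rhoD; exact: ADE.
split; [exact: free|rewrite numE; apply: dimension_formula_free seriesE => k].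
exact: graded_dim_free free homogb.
Qed.

End Criterion.

(** With N one more than the degree of e, only finitely many coefficients are left to
compute. *)
Lemma agree_below N (F : nat -> int) (e : {poly int}) :
  (forall k, (N <= k)%N -> e`_k = 0) -> (forall k, (k < N)%N -> F k = e`_k) ->
  forall k, (k < size e)%N -> F k = e`_k.
Proof.
move=> e0 eF k ke; apply: eF; apply: leq_trans ke _; apply/leq_sizeP => j.
exact: e0.
Qed.

Lemma geq_ltn_neq N k n : (N <= k)%N -> (n < N)%N -> (k == n) = false.
Proof. by move=> Nk nN; apply/eqP; lia. Qed.

Lemma all_below N (P : pred nat) : all P (iota 0 N) -> forall k, (k < N)%N -> P k.
Proof. by move=> /allP PN k kN; apply: PN; rewrite mem_iota. Qed.

Lemma mktuple_colv (A : Type) m (t : m.-tuple (m.-tuple A)) :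
  [tuple colv (tnth t j) | j < m] = [tuple of map (@colv A m) t].
Proof. by apply: eq_from_tnth => j; rewrite tnth_mktuple tnth_map. Qed.

(** * The five modules *)

Section FiveModules.
Variable R : realType.
Local Notation C := R[i].
Local Notation Cxy := {mpoly C[2]}.
Local Notation x := ('X_ord0 : Cxy).
Local Notation y := ('X_ord_max : Cxy).

Lemma kappa2 : kappa R ^+ 2 = 'i%C / 2%:R.
Proof.
by rewrite -(sqr_kappa R) -mulr_natr mulfK ?pnatr_eq0 // expr2.
Qed.

Lemma kappa3 : kappa R ^+ 3 = (-1 + 'i%C) / 4%:R.
Proof.
have i2 : 'i%C * 'i%C = -1 :> C by rewrite -expr2 sqr_i.
rewrite exprS kappa2 /kappa -[X in (X + _) / 4%:R]i2.
by field.
Qed.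

Lemma kappa4_half : 2%:R * kappa R ^+ 4 = -1 / 2%:R.
Proof.
have n2 : 2%:R != 0 :> C by rewrite pnatr_eq0.
apply: (mulIf n2); rewrite divfK // -(kappa4 R); ring.
Qed.

Lemma rho3T_kappa : rho3T R = rho3T_mx (kappa R).
Proof.
apply/matrixP => -[[|//] ?] [[|//] ?]; rewrite !mxE !(tnth_nth 0) /= kappa2.
by rewrite mulrN divfK // pnatr_eq0.
Qed.

Lemma rho5T_kappa : rho5T R = rho5T_mx (kappa R).
Proof. by rewrite /rho5T_mx kappa4_half. Qed.

Lemma rho10T_kappa : rho10T R = rho10T_mx (kappa R).
Proof. by []. Qed.

Lemma rho13T_kappa : rho13T R = rho13T_mx (kappa R).
Proof. by rewrite /rho13T_mx kappa2. Qed.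

Lemma rho15T_kappa : rho15T R = rho15T_mx (kappa R).
Proof. by rewrite /rho15T_mx kappa3. Qed.

Lemma expi3 : 'i%C ^+ 3 = - 'i%C :> C.
Proof. by rewrite exprS sqr_i mulrN1. Qed.

Lemma rho3D_diag : rho3D R = diag_mx (\row_(r < 1) 'i%C ^+ 1).
Proof. by apply/matrixP => -[[|//] ?] [[|//] ?]; rewrite !mxE !(tnth_nth 0) /= expr1. Qed.

Lemma rho5D_diag : rho5D R = diag_mx (\row_(r < 2) 'i%C ^+ (2 * r)).
Proof.
congr diag_mx; apply/rowP => -[[|[|//]] ?]; rewrite !mxE !(tnth_nth 0) /= ?expr0 //.
by rewrite sqr_i.
Qed.

Lemma rho10D_diag : rho10D R = diag_mx (\row_(r < 2) 'i%C ^+ r).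
Proof.
by congr diag_mx; apply/rowP => -[[|[|//]] ?]; rewrite !mxE !(tnth_nth 0) /= ?expr0 ?expr1.
Qed.

Lemma rho13D_diag : rho13D R = diag_mx (\row_(r < 3) 'i%C ^+ r).
Proof.
congr diag_mx; apply/rowP => -[[|[|[|//]]] ?]; rewrite !mxE !(tnth_nth 0) /= ?expr0 ?expr1 //.
by rewrite sqr_i.
Qed.

Lemma rho15D_diag : rho15D R = diag_mx (\row_(r < 4) 'i%C ^+ r).
Proof.
congr diag_mx; apply/rowP => -[[|[|[|[|//]]]] ?];
  rewrite !mxE !(tnth_nth 0) /= ?expr0 ?expr1 ?sqr_i ?expi3 //.
Qed.

Lemma nat_neq0 n : (n.+1)%:R != 0 :> C.
Proof. by rewrite pnatr_eq0. Qed.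

Lemma scale_natr n (p : Cxy) : n%:R * p = (n%:R : C) *: p.
Proof. by rewrite scaler_nat mulr_natl. Qed.

Lemma rho3_module :
  (exists rho, representation_with_values (rho3T R) (rho3D R) rho) /\
  (forall rho, representation_with_values (rho3T R) (rho3D R) rho ->
     free_basis rho [tuple colv (tnth (gen3 x y) j) | j < 1] /\
     dimension_formula rho 'X^6 ((1 - 'X^8) * (1 - 'X^12))
       ('X^6 + 'X^14 + 'X^18 + 'X^22 + 'X^26)).
Proof.
apply: (@free_module_criterion R 1 gen3 rho3T_mx _ _
  (fun=> 1%N) (fun j => 6)%N 1).
- exact: rmorph_gen3.
- exact: rmorph_rho3T.
- exact: gen3_T.
- by move=> A k u v i j; apply: gen3_D.
- exact: rho3T_kappa.
- exact: rho3D_diag.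
- by [].
- by rewrite det_mxrows1 big_ord1 scale1r.
- exact: oner_neq0.
- by move=> [[|//] ?] [[|//] ?]; rewrite !(tnth_nth 0) /=; solve_homog.
- by rewrite !big_ord_recl big_ord0 addr0 ?addrA.
- apply: (agree_below (N := 27)) => k k_small; rewrite !(coefD, mulr_natl, coefMn, coefXn, coefX).
    by rewrite !(geq_ltn_neq k_small).
  rewrite !big_ord_recl big_ord0; apply/eqP; move: k k_small; apply: all_below.
  by vm_compute.
Qed.

Lemma rho5_module :
  (exists rho, representation_with_values (rho5T R) (rho5D R) rho) /\
  (forall rho, representation_with_values (rho5T R) (rho5D R) rho ->
     free_basis rho [tuple colv (tnth (gen5 x y) j) | j < 2] /\
     dimension_formula rho ('X^4 + 'X^8) ((1 - 'X^8) * (1 - 'X^12))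
       ('X^4 + 'X^8 + 'X^12 + 2%:R * 'X^16 + 2%:R * 'X^20)).
Proof.
apply: (@free_module_criterion R 2 gen5 rho5T_mx _ _
  (fun r => (2 * r)%N) (fun j => 4 + 4 * j)%N 18%:R).
- exact: rmorph_gen5.
- exact: rmorph_rho5T.
- exact: gen5_T.
- by move=> A k u v i j; apply: gen5_D.
- exact: rho5T_kappa.
- exact: rho5D_diag.
- by case=> [[|[|//]] ?].
- by rewrite det_gen5 !big_ord_recl big_ord0 scale_natr.
- by rewrite ?oppr_eq0 nat_neq0.
- by move=> [[|[|//]] ?] [[|[|//]] ?]; rewrite !(tnth_nth 0) /=; solve_homog.
- by rewrite !big_ord_recl big_ord0 addr0 ?addrA.
- apply: (agree_below (N := 21)) => k k_small; rewrite !(coefD, mulr_natl, coefMn, coefXn, coefX).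
    by rewrite !(geq_ltn_neq k_small).
  rewrite !big_ord_recl big_ord0; apply/eqP; move: k k_small; apply: all_below.
  by vm_compute.
Qed.

Lemma rho10_module :
  (exists rho, representation_with_values (rho10T R) (rho10D R) rho) /\
  (forall rho, representation_with_values (rho10T R) (rho10D R) rho ->
     free_basis rho [tuple colv (tnth (gen10 x y) j) | j < 2] /\
     dimension_formula rho ('X + 'X^5) ((1 - 'X^8) * (1 - 'X^12))
       ('X + 'X^5 + 'X^9 + 2%:R * 'X^13 + 2%:R * 'X^17 + 2%:R * 'X^21)).
Proof.
apply: (@free_module_criterion R 2 gen10 rho10T_mx _ _
  (fun r => r : nat) (fun j => 1 + 4 * j)%N (- 6%:R)).
- exact: rmorph_gen10.
- exact: rmorph_rho10T.
- exact: gen10_T.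
- by move=> A k u v i j; apply: gen10_D.
- exact: rho10T_kappa.
- exact: rho10D_diag.
- by case=> r rm; apply: leq_trans rm _.
- by rewrite det_gen10 !big_ord_recl big_ord0 mulNr scaleNr scale_natr.
- by rewrite ?oppr_eq0 nat_neq0.
- by move=> [[|[|//]] ?] [[|[|//]] ?]; rewrite !(tnth_nth 0) /=; solve_homog.
- by rewrite !big_ord_recl big_ord0 addr0 ?addrA.
- apply: (agree_below (N := 22)) => k k_small; rewrite !(coefD, mulr_natl, coefMn, coefXn, coefX).
    by rewrite !(geq_ltn_neq k_small).
  rewrite !big_ord_recl big_ord0; apply/eqP; move: k k_small; apply: all_below.
  by vm_compute.
Qed.

Lemma rho13_module :
  (exists rho, representation_with_values (rho13T R) (rho13D R) rho) /\
  (forall rho, representation_with_values (rho13T R) (rho13D R) rho ->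
     free_basis rho [tuple colv (tnth (gen13 x y) j) | j < 3] /\
     dimension_formula rho ('X^2 + 'X^6 + 'X^10) ((1 - 'X^8) * (1 - 'X^12))
       ('X^2 + 'X^6 + 2%:R * 'X^10 + 2%:R * 'X^14 + 3%:R * 'X^18
        + 3%:R * 'X^22)).
Proof.
apply: (@free_module_criterion R 3 gen13 rho13T_mx _ _
  (fun r => r : nat) (fun j => 2 + 4 * j)%N 108%:R).
- exact: rmorph_gen13.
- exact: rmorph_rho13T.
- exact: gen13_T.
- by move=> A k u v i j; apply: gen13_D.
- exact: rho13T_kappa.
- exact: rho13D_diag.
- by case=> r rm; apply: leq_trans rm _.
- by rewrite det_gen13 !big_ord_recl big_ord0 scale_natr.
- by rewrite ?oppr_eq0 nat_neq0.
- by move=> [[|[|[|//]]] ?] [[|[|[|//]]] ?]; rewrite !(tnth_nth 0) /=; solve_homog.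
- by rewrite !big_ord_recl big_ord0 addr0 ?addrA.
- apply: (agree_below (N := 23)) => k k_small; rewrite !(coefD, mulr_natl, coefMn, coefXn, coefX).
    by rewrite !(geq_ltn_neq k_small).
  rewrite !big_ord_recl big_ord0; apply/eqP; move: k k_small; apply: all_below.
  by vm_compute.
Qed.

Lemma rho15_module :
  (exists rho, representation_with_values (rho15T R) (rho15D R) rho) /\
  (forall rho, representation_with_values (rho15T R) (rho15D R) rho ->
     free_basis rho [tuple colv (tnth (gen15 x y) j) | j < 4] /\
     dimension_formula rho ('X^3 + 'X^7 + 'X^11 + 'X^15) ((1 - 'X^8) * (1 - 'X^12))
       ('X^3 + 'X^7 + 2%:R * 'X^11 + 3%:R * 'X^15 + 3%:R * 'X^19
        + 4%:R * 'X^23)).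
Proof.
apply: (@free_module_criterion R 4 gen15 rho15T_mx _ _
  (fun r => r : nat) (fun j => 3 + 4 * j)%N (- 36%:R)).
- exact: rmorph_gen15.
- exact: rmorph_rho15T.
- exact: gen15_T.
- by move=> A k u v i j; apply: gen15_D.
- exact: rho15T_kappa.
- exact: rho15D_diag.
- by case.
- by rewrite det_gen15 !big_ord_recl big_ord0 mulNr scaleNr scale_natr.
- by rewrite ?oppr_eq0 nat_neq0.
- by move=> [[|[|[|[|//]]]] ?] [[|[|[|[|//]]]] ?]; rewrite !(tnth_nth 0) /=; solve_homog.
- by rewrite !big_ord_recl big_ord0 addr0 ?addrA.
- apply: (agree_below (N := 24)) => k k_small; rewrite !(coefD, mulr_natl, coefMn, coefXn, coefX).
    by rewrite !(geq_ltn_neq k_small).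
  rewrite !big_ord_recl big_ord0; apply/eqP; move: k k_small; apply: all_below.
  by vm_compute.
Qed.

End FiveModules.

Theorem theorem3 (R : realType) :
  let x : {mpoly R[i][2]} := 'X_ord0 in
  let y : {mpoly R[i][2]} := 'X_ord_max in
  let den : {poly int} := (1 - 'X^8) * (1 - 'X^12) in
  [/\ (* 1. *)
      (exists rho, representation_with_values (rho3T R) (rho3D R) rho) /\
      (forall rho, representation_with_values (rho3T R) (rho3D R) rho ->
         free_basis rho [tuple colv [tuple - x ^+ 5 * y + x * y ^+ 5]] /\
         dimension_formula rho 'X^6 den
           ('X^6 + 'X^14 + 'X^18 + 'X^22 + 'X^26)),
      (* 2. *)
      (exists rho, representation_with_values (rho5T R) (rho5D R) rho) /\
      (forall rho, representation_with_values (rho5T R) (rho5D R) rho ->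
         free_basis rho
           [tuple
             colv [tuple x ^+ 4 + y ^+ 4;
                         6%:R * x ^+ 2 * y ^+ 2];
             colv [tuple - x ^+ 8 + 10%:R * x ^+ 4 * y ^+ 4 - y ^+ 8;
                         12%:R * x ^+ 6 * y ^+ 2 + 12%:R * x ^+ 2 * y ^+ 6]] /\
         dimension_formula rho ('X^4 + 'X^8) den
           ('X^4 + 'X^8 + 'X^12 + 2%:R * 'X^16 + 2%:R * 'X^20)),
      (* 3. *)
      (exists rho, representation_with_values (rho10T R) (rho10D R) rho) /\
      (forall rho, representation_with_values (rho10T R) (rho10D R) rho ->
         free_basis rho
           [tuple
             colv [tuple x; y];
             colv [tuple - x ^+ 5 + 5%:R * x * y ^+ 4;
                         5%:R * x ^+ 4 * y - y ^+ 5]] /\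
         dimension_formula rho ('X + 'X^5) den
           ('X + 'X^5 + 'X^9 + 2%:R * 'X^13 + 2%:R * 'X^17 + 2%:R * 'X^21)),
      (* 4. *)
      (exists rho, representation_with_values (rho13T R) (rho13D R) rho) /\
      (forall rho, representation_with_values (rho13T R) (rho13D R) rho ->
         free_basis rho
           [tuple
             colv [tuple x ^+ 2; x * y; y ^+ 2];
             colv [tuple - x ^+ 6 + 5%:R * x ^+ 2 * y ^+ 4;
                         2%:R * x ^+ 5 * y + 2%:R * x * y ^+ 5;
                         5%:R * x ^+ 4 * y ^+ 2 - y ^+ 6];
             colv [tuple - x ^+ 2 * (x ^+ 4 - 5%:R * y ^+ 4) ^+ 2;
                         x * y * (5%:R * x ^+ 4 - y ^+ 4)
                           * (x ^+ 4 - 5%:R * y ^+ 4);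
                         - y ^+ 2 * (5%:R * x ^+ 4 - y ^+ 4) ^+ 2]] /\
         dimension_formula rho ('X^2 + 'X^6 + 'X^10) den
           ('X^2 + 'X^6 + 2%:R * 'X^10 + 2%:R * 'X^14 + 3%:R * 'X^18
             + 3%:R * 'X^22))
    & (* 5. *)
      (exists rho, representation_with_values (rho15T R) (rho15D R) rho) /\
      (forall rho, representation_with_values (rho15T R) (rho15D R) rho ->
         free_basis rho
           [tuple
             colv [tuple x ^+ 3; x ^+ 2 * y; x * y ^+ 2; y ^+ 3];
             colv [tuple - x ^+ 7 + 5%:R * x ^+ 3 * y ^+ 4;
                         x ^+ 6 * y + 3%:R * x ^+ 2 * y ^+ 5;
                         3%:R * x ^+ 5 * y ^+ 2 + x * y ^+ 6;
                         5%:R * x ^+ 4 * y ^+ 3 - y ^+ 7];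
             colv [tuple - 6%:R * x ^+ 7 * y ^+ 4 + 6%:R * x ^+ 3 * y ^+ 8;
                         - x ^+ 10 * y + x ^+ 2 * y ^+ 9;
                         x ^+ 9 * y ^+ 2 - x * y ^+ 10;
                         6%:R * x ^+ 8 * y ^+ 3 - 6%:R * x ^+ 4 * y ^+ 7];
             colv [tuple - 24%:R * x ^+ 11 * y ^+ 4 + 24%:R * x ^+ 7 * y ^+ 8;
                         x ^+ 14 * y - 7%:R * x ^+ 10 * y ^+ 5
                           + 3%:R * x ^+ 6 * y ^+ 9 + 3%:R * x ^+ 2 * y ^+ 13;
                         3%:R * x ^+ 13 * y ^+ 2 + 3%:R * x ^+ 9 * y ^+ 6
                           - 7%:R * x ^+ 5 * y ^+ 10 + x * y ^+ 14;
                         24%:R * x ^+ 8 * y ^+ 7 - 24%:R * x ^+ 4 * y ^+ 11]] /\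
         dimension_formula rho ('X^3 + 'X^7 + 'X^11 + 'X^15) den
           ('X^3 + 'X^7 + 2%:R * 'X^11 + 3%:R * 'X^15 + 3%:R * 'X^19
             + 4%:R * 'X^23))].

Proof.
move=> x y den; split.
- have [ex all] := rho3_module R; split; [exact: ex|move=> rho /all[]].
  rewrite mktuple_colv => basis dims; split; last exact dims.
  set b := (X in free_basis _ X).
  by have -> : b = [tuple of map (@colv _ 1) (gen3 x y)] by apply/val_inj.
- have [ex all] := rho5_module R; split; [exact: ex|move=> rho /all[]].
  rewrite mktuple_colv => basis dims; split; last exact dims.
  set b := (X in free_basis _ X).
  by have -> : b = [tuple of map (@colv _ 2) (gen5 x y)] by apply/val_inj.
- have [ex all] := rho10_module R; split; [exact: ex|move=> rho /all[]].
  rewrite mktuple_colv => basis dims; split; last exact dims.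
  set b := (X in free_basis _ X).
  by have -> : b = [tuple of map (@colv _ 2) (gen10 x y)] by apply/val_inj.
- have [ex all] := rho13_module R; split; [exact: ex|move=> rho /all[]].
  rewrite mktuple_colv => basis dims; split; last exact dims.
  set b := (X in free_basis _ X).
  by have -> : b = [tuple of map (@colv _ 3) (gen13 x y)] by apply/val_inj.
- have [ex all] := rho15_module R; split; [exact: ex|move=> rho /all[]].
  rewrite mktuple_colv => basis dims; split; last exact dims.
  set b := (X in free_basis _ X).
  by have -> : b = [tuple of map (@colv _ 4) (gen15 x y)] by apply/val_inj.
Qed.
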